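(* Let $0<\theta<1$ and consider the discrete-time duplication–deletion random graph with parameter $\theta$, with vertices labelled $1,2,\dots$ in the order of birth. Almost surely, the index of the vertex with maximal degree tends to infinity with time; that is, if $I_n$ denotes the smallest label of a vertex having maximal degree in the graph after $n$ steps, then $I_n\to\infty$ almost surely as $n\to\infty$. In particular, there is no persistent hub, i.e. no single vertex that is a vertex of maximal degree at all sufficiently large times.
   Context: Discrete-time duplication–deletion graph with parameter $0<\theta<1$: start from a single vertex without edges. At each step a vertex $v$ is selected uniformly at random among the existing vertices. Independently of the past (and of the choice of $v$), with probability $\theta$ the vertex $v$ is duplicated: a new vertex is added and connected by single edges to $v$ and to all neighbours of $v$. Otherwise, with probability $1-\theta$, $v$ is deleted, meaning that all edges of $v$ are deleted, but the vertex $v$ itself stays in the graph, keeping its label (and may get new edges later). *)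

(* Defs.v *)
From HB Require Import structures.
From mathcomp Require Import all_boot all_order all_algebra.
From mathcomp Require Import all_classical all_reals all_analysis.

Set Implicit Arguments.
Unset Strict Implicit.
Unset Printing Implicit Defensive.

Import Order.TTheory GRing.Theory Num.Theory.

Local Open Scope ring_scope.

(* Graphs on the labelled vertex set {1, ..., nvertices}. Symmetry, irreflexivity
   and the absence of edges outside the vertex set are not fields: they hold for
   [single_vertex] and are preserved by [duplicate] and [isolate] at a vertex
   of the graph (see [simple_graph_dd_graph]). *)
Record lgraph := LGraph { nvertices : nat; adj : rel nat }.

Definition vertices (g : lgraph) : seq nat := iota 1 (nvertices g).

Definition degree (g : lgraph) (v : nat) : nat :=
  count (adj g v) (vertices g).

Definition max_degree (g : lgraph) : nat :=
  (\max_(v <- vertices g) degree g v)%N.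

Definition has_max_degree (g : lgraph) (v : nat) : bool :=
  (v \in vertices g) && (degree g v == max_degree g).

(* [vertices g] is increasing, so the head is the smallest such label. The
   default 0 is only used for the graph without vertices. *)
Definition max_degree_index (g : lgraph) : nat :=
  head 0%N [seq v <- vertices g | has_max_degree g v].

Definition single_vertex : lgraph := LGraph 1 (fun _ _ => false).

Definition duplicate (g : lgraph) (v : nat) : lgraph :=
  let new := (nvertices g).+1 in
  LGraph new (fun x y =>
    [|| adj g x y,
        (x == new) && ((y == v) || adj g v y) |
        (y == new) && ((x == v) || adj g v x)]).

(* The "deletion" of v: only the edges of v disappear. *)
Definition isolate (g : lgraph) (v : nat) : lgraph :=
  LGraph (nvertices g) (fun x y => [&& adj g x y, x != v & y != v]).

(* The graph after n steps; step i.+1 acts on the vertex [v i], which is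
   duplicated if [b i] and deleted otherwise. *)
Fixpoint dd_graph (v : nat -> nat) (b : nat -> bool) (n : nat) : lgraph :=
  if n is m.+1 then
    let g := dd_graph v b m in
    if b m then duplicate g (v m) else isolate g (v m)
  else single_vertex.

Definition simple_graph (g : lgraph) : Prop :=
  [/\ symmetric (adj g), irreflexive (adj g) &
      forall x y, adj g x y -> (x \in vertices g) && (y \in vertices g)].

Lemma simple_graph_dd_graph (v : nat -> nat) (b : nat -> bool) (n : nat) :
  (forall m, (m < n)%N -> v m \in vertices (dd_graph v b m)) ->
  simple_graph (dd_graph v b n).
Proof.
elim: n => [//|n IHn] vP.
have {IHn} [gs gi gv] := IHn (fun m mn => vP m (ltnW mn)).
have {vP} := vP n (ltnSn n).
rewrite /=; move: (dd_graph v b n) (v n) gs gi gv => g {}v gs gi gv vg.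
have newP x : x \in vertices g -> x != (nvertices g).+1.
  by rewrite mem_iota add1n => /andP[_]; apply: contraTN => /eqP->; rewrite ltnn.
have sub x : x \in vertices g -> x \in iota 1 (nvertices g).+1.
  by rewrite !mem_iota !add1n => /andP[-> /ltnW].
have newS : (nvertices g).+1 \in iota 1 (nvertices g).+1 by rewrite mem_iota /= add1n.
have vu u : (u == v) || adj g v u -> u \in vertices g.
  by case/orP => [/eqP->//|/gv/andP[]].
case: (b n); split=> [x y|x|x y] /=.
- by rewrite gs; congr (_ || _); rewrite orbC.
- rewrite gi orbb /=; apply/negP => /andP[/eqP xE] /vu /newP.
  by rewrite xE eqxx.
- rewrite /vertices /=.
  case/or3P => [/gv/andP[/sub-> /sub->]//|/andP[/eqP-> /vu/sub->]|].
    by rewrite newS.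
  by move=> /andP[/eqP-> /vu/sub->].
- by rewrite gs; congr (_ && _); rewrite andbC.
- by rewrite gi.
- by case/and3P => /gv.
Qed.

Section process.
Context (d : measure_display) (Omega : measurableType d) (R : realType).
Variables (P : probability Omega R) (theta : R).
Variables (V : nat -> {mfun Omega >-> nat}) (B : nat -> {mfun Omega >-> bool}).

(* The event that the selected vertices and the coins of the first n steps are
   those prescribed by v and b. These events are the atoms of the discrete
   sigma-algebra of the past at time n. *)
Definition past (n : nat) (v : nat -> nat) (b : nat -> bool) : set Omega :=
  [set w | forall i, (i < n)%N -> V i w = v i /\ B i w = b i]%classic.

(* Given any past, the vertex [V n] is uniform among the vertices of the
   current graph; given any past and any value of [V n], the coin [B n] shows
   "duplicate" with probability theta. *)
Definition duplication_deletion : Prop :=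
  (forall n v b x,
     P (past n v b `&` [set w | V n w = x])%classic =
     (P (past n v b) *
      ((x \in vertices (dd_graph v b n))%:R / (nvertices (dd_graph v b n))%:R)%:E)%E)
  /\
  (forall n v b x,
     P (past n v b `&` [set w | V n w = x] `&` [set w | B n w = true])%classic =
     (P (past n v b `&` [set w | V n w = x])%classic * theta%:E)%E).

Definition random_graph (n : nat) (w : Omega) : lgraph :=
  dd_graph (fun i => V i w) (fun i => B i w) n.

End process.

(* Main.v *)
Require Import Defs.
From HB Require Import structures.
From mathcomp Require Import all_boot all_order all_algebra.
From mathcomp Require Import all_classical all_reals all_analysis.
From mathcomp Require Import ring lra zify.

(** The graph is at all times a disjoint union of cliques, so the degree of a
    vertex is one less than the size of its clique. The clique of a fixed vertex
    v behaves like any other clique, except that it is reset to size 1 whenever v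
    itself is deleted. Let x be the size of the clique of v and y the size of a
    largest clique. Since the growth rates of x and of y cancel in a quotient,
    r = x (x + 1) / (y (y + 1)) decreases at rate (1 - theta) / N because of the
    resets, up to an error O(1 / (N y^2)), where N is the number of vertices.
    As soon as y >= c log n and N >= c n, this error is summable even after
    multiplication by sqrt (log n); hence sqrt (log n) r, up to a deterministic
    summand, is a nonnegative supermartingale, it stays bounded, and r tends to
    0, whereas r = 1 whenever v has maximal degree.

    The lower bound on y follows from the number W_k of vertices of degree at
    least k: each step changes W_(k+1) by at least
    (theta W_(k+1) + (k + 2) (theta W_k - W_(k+1))) / N on average, a triangular
    system with equilibrium W_k = theta^k N. A weighted sum of the squares of
    the positive parts of theta^k N - W_k grows at most linearly on average,
    hence is O(n^(3/2)) almost surely, and this forces W_k > 0 up to k of order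
    log n. The deviation (N - 1 - theta n)^2 is controlled along with it. *)

Set Implicit Arguments.
Unset Strict Implicit.
Unset Printing Implicit Defensive.

Import Order.TTheory GRing.Theory Num.Theory.

Lemma count_eq0 (T : eqType) (a : pred T) (s : seq T) :
  {in s, forall x, ~~ a x} -> count a s = 0.
Proof. by move=> /hasPn; rewrite has_count -eqn0Ngt => /eqP. Qed.

Lemma leq_in_count (T : eqType) (a1 a2 : pred T) (s : seq T) :
  {in s, forall x, a1 x -> a2 x} -> (count a1 s <= count a2 s)%N.
Proof.
move=> a12; rewrite -(@eq_in_count _ (predI a1 a2)); first by apply: sub_count => x /= /andP[].
by move=> x /a12 /=; case: (a1 x) => //= ->.
Qed.

(** * Cliques *)

Definition same_clique (g : lgraph) : rel nat := fun x y => (x == y) || adj g x y.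

(** [same_clique] is reflexive, and symmetric for a simple graph, so transitivity makes it an
    equivalence relation: the graph is a disjoint union of cliques. *)
Definition clique_graph (g : lgraph) : Prop :=
  [/\ simple_graph g, transitive (same_clique g) & 0 < nvertices g].

Lemma vertices_duplicate g x :
  vertices (duplicate g x) = rcons (vertices g) (nvertices g).+1.
Proof. by rewrite /vertices -cats1 -[nvertices (duplicate _ _)]addn1 iotaD add1n. Qed.

Lemma vertices_isolate g x : vertices (isolate g x) = vertices g.
Proof. by []. Qed.

Lemma size_vertices g : size (vertices g) = nvertices g.
Proof. exact: size_iota. Qed.

Lemma uniq_vertices g : uniq (vertices g).
Proof. exact: iota_uniq. Qed.

Lemma new_vertex_neq g x : x \in vertices g -> (x == (nvertices g).+1) = false.
Proof. by rewrite mem_iota add1n => /andP[_]; apply: contraTF => /eqP->; rewrite ltnn. Qed.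

Lemma same_clique_sym g : simple_graph g -> symmetric (same_clique g).
Proof. by move=> [gs _ _] x y; rewrite /same_clique eq_sym gs. Qed.

Lemma same_clique_refl g x : same_clique g x x.
Proof. by rewrite /same_clique eqxx. Qed.

Lemma same_clique_vertices g x y : simple_graph g ->
  same_clique g x y -> x \in vertices g -> y \in vertices g.
Proof. by move=> [_ _ gv] /orP[/eqP->//|/gv/andP[]]. Qed.

Lemma count_same_clique g x : simple_graph g -> x \in vertices g ->
  count (same_clique g x) (vertices g) = (degree g x).+1.
Proof.
move=> [_ gi _] xg; rewrite -add1n /degree.
have <- : count (pred1 x) (vertices g) = 1 by rewrite count_uniq_mem ?uniq_vertices// xg.
rewrite -count_predUI -[LHS]addn0; congr (_ + _).
  by apply: eq_count => y; rewrite /= /same_clique eq_sym.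
apply/esym/count_eq0 => y _ /=.
by apply/negP => /andP[/eqP->]; rewrite gi.
Qed.

Lemma degree_same_clique g x y : clique_graph g -> x \in vertices g ->
  same_clique g x y -> degree g x = degree g y.
Proof.
move=> [gS gt _] xg xy; apply: succn_inj.
have yg := same_clique_vertices gS xy xg.
rewrite -!count_same_clique//; apply: eq_count => z.
by apply/idP/idP; apply: gt => //; rewrite same_clique_sym.
Qed.

Lemma degree_lt_nvertices g x : simple_graph g -> x \in vertices g ->
  degree g x < nvertices g.
Proof. by move=> gS xg; rewrite -count_same_clique// -size_vertices count_size. Qed.

Lemma degree_duplicate_old g x z : simple_graph g -> z \in vertices g ->
  degree (duplicate g x) z = degree g z + same_clique g x z.
Proof.
move=> gS zg; have [gs gi gv] := gS.
rewrite /degree vertices_duplicate -cats1 count_cat /= addn0; congr (_ + _).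
  apply: eq_in_count => y yg /=.
  by rewrite (new_vertex_neq zg) (new_vertex_neq yg) /= orbF.
rewrite eqxx (new_vertex_neq zg) /=; congr (nat_of_bool _).
rewrite /same_clique (eq_sym x); case: (boolP (adj g z _)) => //= /gv/andP[_].
by move/new_vertex_neq; rewrite eqxx.
Qed.

Lemma degree_duplicate_new g x : simple_graph g -> x \in vertices g ->
  degree (duplicate g x) (nvertices g).+1 = (degree g x).+1.
Proof.
move=> gS xg; have [gs gi gv] := gS.
rewrite /degree vertices_duplicate -cats1 count_cat /= addn0.
rewrite eqxx /= (eq_sym _ x) (new_vertex_neq xg) /=.
have nadj y : adj g y (nvertices g).+1 = false.
  by apply/negP => /gv/andP[_] /new_vertex_neq; rewrite eqxx.
rewrite !nadj addn0 -count_same_clique//; apply: eq_in_count => y yg /=.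
by rewrite gs nadj (new_vertex_neq yg)/= orbF /same_clique eq_sym.
Qed.

Lemma degree_isolate g x z : simple_graph g -> x \in vertices g ->
  degree (isolate g x) z = if z == x then 0 else degree g z - adj g x z.
Proof.
move=> gS xg; have [gs gi gv] := gS.
rewrite /degree vertices_isolate; case: eqVneq => [->|zx] /=.
  by apply: count_eq0 => y _ /=; rewrite eqxx andbF.
rewrite (gs x z).
set b := adj g z x; set P := fun y => _.
(* The single neighbour that z may lose is written as a count, so that inclusion-exclusion
   applies. *)
have <- : count (fun y => (y == x) && b) (vertices g) = b.
  case: b; last by rewrite (eq_count (a2 := pred0)) ?count_pred0// => y; rewrite andbF.
  rewrite (eq_count (a2 := pred1 x)) ?count_uniq_mem ?uniq_vertices ?xg// => y.
  by rewrite andbT.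
apply/esym/eqP; rewrite -(eqn_add2r (count (fun y => (y == x) && b) (vertices g))).
rewrite subnK; last by apply: sub_count => y /= /andP[/eqP->].
rewrite -count_predUI -[eqbLHS]addn0; apply/eqP; congr (_ + _).
  apply: eq_count => y /=; rewrite /P /b zx /=.
  by case: eqVneq => [->|]; rewrite ?andbF ?orbF ?andbT.
apply/esym/count_eq0 => y _ /=.
by rewrite /P; case: (eqVneq y x); rewrite ?andbF.
Qed.

Lemma clique_graph_single_vertex : clique_graph single_vertex.
Proof.
split; [by split | | by []].
by move=> x y z; rewrite /same_clique /= !orbF => /eqP->.
Qed.

Lemma simple_graph_step g x b : simple_graph g -> x \in vertices g ->
  simple_graph (if b then duplicate g x else isolate g x).
Proof.
move=> [gs gi gv] xg.
have sub y : y \in vertices g -> y \in vertices (duplicate g x).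
  by rewrite vertices_duplicate mem_rcons in_cons orbC => ->.
have newS : (nvertices g).+1 \in vertices (duplicate g x).
  by rewrite vertices_duplicate mem_rcons in_cons eqxx.
have xu u : (u == x) || adj g x u -> u \in vertices g.
  by case/orP => [/eqP->//|/gv/andP[]].
case: b; split=> [y z|y|y z] /=.
- by rewrite gs; congr (_ || _); rewrite orbC.
- rewrite gi orbb /=; apply/negP => /andP[/eqP yE] /xu.
  by rewrite yE => /new_vertex_neq; rewrite eqxx.
- case/or3P => [/gv/andP[/sub-> /sub->]//|/andP[/eqP-> /xu/sub->]|].
    by rewrite newS.
  by move=> /andP[/eqP-> /xu/sub->].
- by rewrite gs; congr (_ && _); rewrite andbC.
- by rewrite gi.
- by case/and3P => /gv.
Qed.

Lemma clique_graph_step g x b : clique_graph g -> x \in vertices g ->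
  clique_graph (if b then duplicate g x else isolate g x).
Proof.
move=> [gS gt g0] xg; split; [exact: simple_graph_step | | by case: b].
have [gs gi gv] := gS.
have new0 y : adj g (nvertices g).+1 y = false.
  by apply/negP => /gv/andP[/new_vertex_neq]; rewrite eqxx.
have sym := same_clique_sym gS.
case: b; last first.
  move=> y w z; rewrite /same_clique /=.
  case: (eqVneq w y) => [->//|wy] /=.
  case: (eqVneq y z) => [->|yz] /=; first by rewrite orbC => ->.
  move=> /and3P[awy wx yx] /and3P[ayz _ zx].
  have := gt y w z; rewrite /same_clique awy ayz !orbT => /(_ isT isT).
  by rewrite wx zx !andbT.
(* relabelling the new vertex as its parent x turns the new relation into the old one *)
pose f y := if y == (nvertices g).+1 then x else y.
have fE y z : same_clique (duplicate g x) y z = same_clique g (f y) (f z).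
  rewrite /same_clique /= /f.
  case: (eqVneq y (nvertices g).+1) => [->|yn];
    case: (eqVneq z (nvertices g).+1) => [->|zn] //=.
  - by rewrite !eqxx.
  - by rewrite new0 orbF (eq_sym z).
  - by rewrite (negPf yn) gs new0 /= (gs y x).
  - by rewrite orbF.
by move=> y w z; rewrite !fE; exact: gt.
Qed.

Local Open Scope classical_set_scope.
Local Open Scope ring_scope.

(** * Supermartingales along the process *)

(** The conditional expectation of f at the next graph, given that the current graph is g. *)
Definition step_mean (R : realType) (theta : R) (f : lgraph -> R) (g : lgraph) : R :=
  (\sum_(x <- vertices g)
     (theta * f (duplicate g x) + (1 - theta) * f (isolate g x))) /
  (nvertices g)%:R.

(* Only what the estimates need to know about the graph after n steps. *)
Definition reachable (n : nat) (g : lgraph) : Prop :=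
  clique_graph g /\ (nvertices g <= n.+1)%N.

Lemma reachable_step n g x b : reachable n g -> x \in vertices g ->
  reachable n.+1 (if b then duplicate g x else isolate g x).
Proof.
move=> [gc gn] xg; split; first exact: clique_graph_step.
by case: b => /=; [|exact: leq_trans gn _].
Qed.

Lemma reachable0 : reachable 0 single_vertex.
Proof. by split=> //; exact: clique_graph_single_vertex. Qed.

Definition update (T : Type) (f : nat -> T) (n : nat) (x : T) : nat -> T :=
  fun i => if i == n then x else f i.

Lemma eq_dd_graph v b v' b' n :
  (forall i, (i < n)%N -> v i = v' i /\ b i = b' i) ->
  dd_graph v b n = dd_graph v' b' n.
Proof.
elim: n => [//|n IHn] eqvb /=.
have [-> ->] := eqvb n (ltnSn n).
by rewrite IHn// => i /ltnW/eqvb.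
Qed.

Lemma dd_graph_update v b n x c :
  dd_graph (update v n x) (update b n c) n.+1 =
  if c then duplicate (dd_graph v b n) x else isolate (dd_graph v b n) x.
Proof.
rewrite /= {2 4}/update eqxx (@eq_dd_graph _ _ v b) /update ?eqxx//.
by move=> i; case: ltngtP.
Qed.

Section supermartingale.
Context (d : measure_display) (Omega : measurableType d) (R : realType).
Variables (P : probability Omega R) (theta : R).
Variables (V : nat -> {mfun Omega >-> nat}) (B : nat -> {mfun Omega >-> bool}).
Hypothesis VB : duplication_deletion P theta V B.

Local Notation pr A := (fine (P A)).
Local Notation G := (random_graph V B).

Let pr_fin A : measurable A -> P A = (pr A)%:E.
Proof. by move=> mA; rewrite fineK// fin_num_measure. Qed.

Let pr_ge0 A : 0 <= pr A.
Proof. by rewrite fine_ge0. Qed.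

Let pr_le A C : measurable A -> measurable C -> A `<=` C -> pr A <= pr C.
Proof.
move=> mA mC AC; rewrite fine_le ?fin_num_measure//.
by apply: le_measure; rewrite ?inE.
Qed.

Let prU A C : measurable A -> measurable C -> pr (A `|` C) <= pr A + pr C.
Proof.
move=> mA mC; rewrite -lee_fin EFinD -!pr_fin//; last exact: measurableU.
exact: measureU2.
Qed.

Lemma measurable_V n x : measurable [set w | V n w = x].
Proof. exact: (measurable_funPTI (V n) (Y := [set x])). Qed.

Lemma measurable_B n x : measurable [set w | B n w = x].
Proof. exact: (measurable_funPTI (B n) (Y := [set x])). Qed.

Lemma past_update n v b x c :
  past V B n.+1 (update v n x) (update b n c) =
  past V B n v b `&` [set w | V n w = x] `&` [set w | B n w = c].
Proof.
apply/seteqP; split=> w /=.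
  move=> h; have := h n (ltnSn n); rewrite /update eqxx => -[-> ->].
  by do 2 split=> //; move=> i ni; have := h i (ltnW ni); rewrite /update ltn_eqF.
move=> [[h hV] hB] i; rewrite /update ltnS leq_eqVlt; case: eqVneq => [->//|_ /=].
exact: h.
Qed.

Lemma measurable_past n v b : measurable (past V B n v b).
Proof.
elim: n => [|n IHn].
  by rewrite (_ : past _ _ _ _ _ = setT)//; apply/seteqP; split.
rewrite (_ : past _ _ _ _ _ = past V B n.+1 (update v n (v n)) (update b n (b n))).
  rewrite past_update; apply: measurableI; last exact: measurable_B.
  by apply: measurableI => //; exact: measurable_V.
by congr past; apply/funext => i; rewrite /update; case: eqVneq => [->|].
Qed.

Lemma random_graph_past n v b w : past V B n v b w -> G n w = dd_graph v b n.
Proof. exact: eq_dd_graph. Qed.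

(** Finite lists provide countably many codes for the pasts. For a list of length n, the first n
    steps never read the default. *)
Definition history (h : seq (nat * bool)) : (nat -> nat) * (nat -> bool) :=
  (fun i => (nth (0%N, false) h i).1, fun i => (nth (0%N, false) h i).2).

Lemma past_history n w :
  let h := history (mkseq (fun i => (V i w, B i w)) n) in
  past V B n h.1 h.2 w.
Proof. by move=> /= i ni; rewrite /= nth_mkseq. Qed.

(** The graph after n steps is constant on each past of length n, so the event is a countable union
    of pasts, for any predicate D. *)
Lemma measurable_random_graph n (D : lgraph -> Prop) : measurable [set w | D (G n w)].
Proof.
have -> : [set w | D (G n w)] =
    \bigcup_h [set w | past V B n (history h).1 (history h).2 w /\
                       D (dd_graph (history h).1 (history h).2 n)].
  apply/seteqP; split=> w /=.
    move=> Dw; exists (mkseq (fun i => (V i w, B i w)) n) => //.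
    have pw := @past_history n w; split=> //.
    by rewrite -(random_graph_past pw).
  by move=> [h _ /= [pw]]; rewrite -(random_graph_past pw).
apply: countable_bigcupT_measurable => [|h]; first exact: countableP.
have [Dh|nDh] := pselect (D (dd_graph (history h).1 (history h).2 n)).
  rewrite (_ : [set w | _] = past V B n (history h).1 (history h).2).
    exact: measurable_past.
  by apply/seteqP; split=> w //= [].
by rewrite (_ : [set w | _] = set0)//; apply/seteqP; split=> w //= [].
Qed.

Lemma pr_past_vertex n v b x : x \in vertices (dd_graph v b n) ->
  pr (past V B n v b `&` [set w | V n w = x]) =
  pr (past V B n v b) / (nvertices (dd_graph v b n))%:R.
Proof.
move=> xg; rewrite VB.1 xg mul1r pr_fin ?fineM//.
exact: measurable_past.
Qed.

Lemma pr_past_update n v b x c : x \in vertices (dd_graph v b n) ->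
  pr (past V B n.+1 (update v n x) (update b n c)) =
  pr (past V B n v b) / (nvertices (dd_graph v b n))%:R *
  (if c then theta else 1 - theta).
Proof.
move=> xg; rewrite past_update -(pr_past_vertex xg).
set A := _ `&` [set w | V n w = x].
have mA : measurable A.
  by apply: measurableI; [exact: measurable_past|exact: measurable_V].
have prT : pr (A `&` [set w | B n w = true]) = pr A * theta.
  by rewrite VB.2 -/A pr_fin//.
(* [VB] prescribes the outcome [true] of the coin; the outcome [false] gets the remaining share by
   additivity. *)
case: c => //; rewrite mulrBr mulr1 -prT; apply/eqP; rewrite eq_sym subr_eq; apply/eqP.
apply: EFin_inj; rewrite EFinD -!pr_fin//; try by apply: measurableI => //; exact: measurable_B.
rewrite -measureU; try by apply: measurableI => //; exact: measurable_B.
  by rewrite -setIUr; congr (P _); apply/seteqP; split=> w //=; [|by case]; case: (B n w); auto.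
by apply/seteqP; split=> w //= [[_ ->] []].
Qed.

Lemma negligible_past_not_vertex n v b :
  P.-negligible
    (past V B n v b `&` [set w | V n w \notin vertices (dd_graph v b n)]).
Proof.
apply: (@negligibleS _ _ _ _ (\bigcup_x (if x \in vertices (dd_graph v b n) then set0
    else past V B n v b `&` [set w | V n w = x]))).
  by move=> w [/= pw Vw]; exists (V n w) => //; rewrite (negPf Vw).
apply: negligible_bigcup => x; case: ifPn => [_|xg]; first exact: negligible_set0.
apply/negligibleP; last by apply: etrans (VB.1 n v b x) _; rewrite (negPf xg) mul0r mule0.
by apply: measurableI; [exact: measurable_past|exact: measurable_V].
Qed.

Lemma ae_reachable : {ae P, forall w n, reachable n (G n w)}.
Proof.
have aeV : {ae P, forall w n, V n w \in vertices (G n w)}.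
  apply: ae_foralln => n.
  (* An enumeration of the countably many histories; a number that decodes to no history contributes
     the empty set. *)
  pose N (k : nat) := if unpickle k is Some h then
    past V B n (history h).1 (history h).2 `&`
    [set w | V n w \notin vertices (dd_graph (history h).1 (history h).2 n)] else set0.
  apply: (@negligibleS _ _ _ _ (\bigcup_k N k)); last first.
    apply: negligible_bigcup => k; rewrite /N; case: unpickle => [h|].
      exact: negligible_past_not_vertex.
    exact: negligible_set0.
  move=> w /= /negP Vw; have pw := @past_history n w.
  exists (pickle (mkseq (fun i => (V i w, B i w)) n)) => //.
  by rewrite /N pickleK; split=> //=; rewrite -(random_graph_past pw).
apply: filterS aeV => w Vw; elim=> [|n IHn]; first exact: reachable0.
exact: (reachable_step (B n w) IHn).
Qed.

(** The one-step continuations cover the past up to the null event that the selected label is not a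
    vertex, so a union bound over the vertices suffices. *)
Let pr_past_split n v b (E : set Omega) : measurable E ->
  pr (past V B n v b `&` E) <=
  \sum_(x <- vertices (dd_graph v b n))
    (pr (past V B n.+1 (update v n x) (update b n true) `&` E) +
     pr (past V B n.+1 (update v n x) (update b n false) `&` E)).
Proof.
move=> mE; set g := dd_graph v b n.
have mpast := measurable_past; have mV := measurable_V; have mB := measurable_B.
have [N [mN N0 subN]] := negligible_past_not_vertex n v b.
pose S (s : seq nat) := [set w | past V B n v b w /\ E w /\ V n w \in s].
have SE x s : S (x :: s) =
    (past V B n.+1 (update v n x) (update b n true) `&` E) `|`
    (past V B n.+1 (update v n x) (update b n false) `&` E) `|` S s.
  rewrite !past_update; apply/seteqP; split=> w /=.
    move=> [pw [Ew]]; rewrite inE => /orP[/eqP Vx|Vs]; last by right.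
    by left; case Bw: (B n w); [left|right].
  move=> [[[[[pw Vx] Bw] Ew]|[[[pw Vx] Bw] Ew]]|[pw [Ew Vs]]];
    by split=> //; split=> //; rewrite inE ?Vx ?eqxx ?Vs ?orbT.
have S0 : S [::] = set0 by apply/seteqP; split=> w //= [_ []].
have SP s : measurable (S s) /\ pr (S s) <= \sum_(x <- s)
    (pr (past V B n.+1 (update v n x) (update b n true) `&` E) +
     pr (past V B n.+1 (update v n x) (update b n false) `&` E)).
  elim: s => [|x s [mS IHs]]; first by rewrite S0 big_nil measure0.
  have mU c : measurable (past V B n.+1 (update v n x) (update b n c) `&` E).
    by apply: measurableI.
  rewrite SE; split; first by apply: measurableU => //; apply: measurableU.
  rewrite big_cons; apply: le_trans (prU _ mS) _; first exact: measurableU.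
  by apply: lerD IHs; exact: prU.
have [mS SV] := SP (vertices g); apply: le_trans _ SV.
apply: (@le_trans _ _ (pr (S (vertices g) `|` N))).
  apply: pr_le; [exact: measurableI|exact: measurableU|move=> w [pw Ew]].
  case: (boolP (V n w \in vertices g)) => Vg; first by left.
  by right; apply: subN.
by apply: le_trans (prU mS mN) _; rewrite N0 /= addr0.
Qed.

(** * A maximal inequality for stopped supermartingales *)

Section hitting.
Variables (F : nat -> lgraph -> R) (A : nat -> lgraph -> Prop) (lambda : R).

(** Stopping is built in: a path is abandoned once A fails before the level is reached, so the drift
    condition is used only where A holds. *)
Fixpoint hit (T k : nat) : set Omega :=
  [set w | lambda <= F k (G k w)] `|`
  if T is T'.+1 then [set w | A k (G k w)] `&` hit T' k.+1 else set0.

Lemma measurable_hit T k : measurable (hit T k).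
Proof.
elim: T k => [|T IHT] k /=; apply: measurableU => //; try
  exact: (@measurable_random_graph k (fun g => lambda <= F k g)).
by apply: measurableI => //; exact: measurable_random_graph.
Qed.

Hypothesis lambda_gt0 : 0 < lambda.
Hypothesis F_ge0 : forall n g, reachable n g -> 0 <= F n g.
Hypothesis F_step : forall n g, reachable n g -> A n g ->
  step_mean theta (F n.+1) g <= F n g.

(* Ville's maximal inequality, by backward induction over the histories *)
Lemma pr_hit T k v b : reachable k (dd_graph v b k) ->
  pr (past V B k v b `&` hit T k) <=
  pr (past V B k v b) * (F k (dd_graph v b k) / lambda).
Proof.
have mpast := measurable_past.
elim: T k v b => [|T IHT] k v b gr; set g := dd_graph v b k in gr *;
  have [Fl|Fl] := leP lambda (F k g).
- apply: (@le_trans _ _ (pr (past V B k v b))).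
    by apply: pr_le => //; apply: measurableI => //; exact: measurable_hit.
  by rewrite ler_peMr// ler_pdivlMr// mul1r.
- rewrite (_ : past V B k v b `&` hit 0 k = set0) ?measure0
    ?mulr_ge0 ?divr_ge0 ?F_ge0 ?invr_ge0 ?(ltW lambda_gt0)//.
  apply/seteqP; split=> w //= [pw []//]; rewrite (random_graph_past pw).
  by rewrite leNgt Fl.
- apply: (@le_trans _ _ (pr (past V B k v b))).
    by apply: pr_le => //; apply: measurableI => //; exact: measurable_hit.
  by rewrite ler_peMr// ler_pdivlMr// mul1r.
have [Ag|nAg] := pselect (A k g); last first.
  rewrite (_ : past V B k v b `&` hit T.+1 k = set0) ?measure0
    ?mulr_ge0 ?divr_ge0 ?F_ge0 ?invr_ge0 ?(ltW lambda_gt0)//.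
  apply/seteqP; split=> w //= [pw [|[]]]; rewrite (random_graph_past pw)//.
  by rewrite leNgt Fl.
apply: (@le_trans _ _ (pr (past V B k v b `&` hit T k.+1))).
  apply: pr_le; do ?[by apply: measurableI => //; exact: measurable_hit].
  move=> w [pw /=]; rewrite (random_graph_past pw) => -[|[_ hw]]; last by split.
  by rewrite leNgt Fl.
apply: le_trans (pr_past_split _ _ _ (measurable_hit _ _)) _.
have Fs := F_step gr Ag.
rewrite -/g; apply: (@le_trans _ _ (pr (past V B k v b) / lambda * step_mean theta (F k.+1) g)).
  rewrite /step_mean mulrA mulrAC big_seq_cond [X in _ <= _ * X]big_seq_cond mulr_sumr.
  apply: ler_sum => x /andP[xg _].
  have IH c : pr (past V B k.+1 (update v k x) (update b k c) `&` hit T k.+1) <=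
      pr (past V B k v b) / (nvertices g)%:R * (if c then theta else 1 - theta) *
      (F k.+1 (if c then duplicate g x else isolate g x) / lambda).
    rewrite -(pr_past_update _ xg) -dd_graph_update; apply: IHT.
    by rewrite dd_graph_update; exact: reachable_step.
  apply: le_trans (lerD (IH true) (IH false)) _; rewrite le_eqVlt; apply/orP; left.
  by apply/eqP; ring.
by rewrite mulrAC -mulrA; apply: ler_wpM2l => //; rewrite ler_wpM2r// invr_ge0 ltW.
Qed.

Lemma hit_eventually T k w : (forall i, (k <= i)%N -> A i (G i w)) ->
  lambda <= F (k + T) (G (k + T) w) -> hit T k w.
Proof.
elim: T k => [|T IHT] k Ak; first by rewrite addn0 => ?; left.
rewrite addnS -addSn => Fl; right; split; first exact: Ak.
by apply: IHT => // i /ltnW/Ak.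
Qed.

Lemma nondecreasing_hit k : nondecreasing_seq (fun T => hit T k).
Proof.
apply/nondecreasing_seqP => T; apply/subsetPset.
elim: T k => [|T IHT] k w /= [Fl|]; [by left|by []|by left|].
by move=> [Ak /IHT hw]; right.
Qed.

End hitting.

(** By the maximal inequality, level m + 1 is reached with probability O(1 / (m + 1)), so
    unboundedness while A persists is null for each starting time and past. There are countably many
    of these, and the starting time absorbs that A holds only eventually. *)
Lemma ae_bounded (F : nat -> lgraph -> R) (A : nat -> lgraph -> Prop) :
  (forall n g, reachable n g -> 0 <= F n g) ->
  (forall n g, reachable n g -> A n g -> step_mean theta (F n.+1) g <= F n g) ->
  {ae P, forall w, (\forall n \near \oo, A n (G n w)) ->
    exists L, \forall n \near \oo, F n (G n w) <= L}.
Proof.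
move=> F_ge0 F_step; have mpast := measurable_past.
pose bad k v b := [set w | reachable k (dd_graph v b k) /\ past V B k v b w /\
  (forall i, (k <= i)%N -> A i (G i w)) /\
  forall L, exists2 n, (k <= n)%N & L <= F n (G n w)].
have bad0 k v b : P.-negligible (bad k v b).
  have [gr|ngr] := pselect (reachable k (dd_graph v b k)); last first.
    by apply: negligibleS (@negligible_set0 _ _ _ P) => w [].
  pose C m := \bigcup_T (past V B k v b `&` hit F A m.+1%:R T k).
  have mC m : measurable (C m).
    by apply: bigcupT_measurable => T; apply: measurableI => //; exact: measurable_hit.
  have PC m : (P (C m) <= (pr (past V B k v b) * (F k (dd_graph v b k) / m.+1%:R))%:E)%E.
    have mH T : measurable (past V B k v b `&` hit F A m.+1%:R T k).
      by apply: measurableI => //; exact: measurable_hit.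
    (* Continuity from below as the horizon T grows. *)
    have cvC : P \o (fun T => past V B k v b `&` hit F A m.+1%:R T k) @ \oo --> P (C m).
      apply: nondecreasing_cvg_mu; [exact: mH|exact: mC|].
      move=> T T' TT'; apply/subsetPset; apply: setIS.
      by apply/subsetPset; exact: nondecreasing_hit.
    rewrite -(cvg_lim _ cvC)//; apply: lime_le; first by apply/cvg_ex; exists (P (C m)).
    by apply: nearW => T /=; rewrite pr_fin// lee_fin; exact: pr_hit.
  exists (\bigcap_m C m); split; first exact: bigcapT_measurable.
    apply/eqP; rewrite -measure_le0; apply/lee_addgt0Pr => e e0; rewrite add0e.
    pose a := pr (past V B k v b) * F k (dd_graph v b k).
    have [m am] : exists m : nat, a / m.+1%:R <= e.
      have a0 : 0 <= a by rewrite mulr_ge0 ?F_ge0.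
      exists (Num.truncn (a / e)); rewrite ler_pdivrMr// mulrC -ler_pdivrMr//.
      by rewrite ltW// truncnS_gt.
    apply: (@le_trans _ _ (P (C m))); last first.
      by apply: le_trans (PC m) _; rewrite lee_fin mulrA.
    by apply: le_measure; rewrite ?inE//; [exact: bigcapT_measurable|exact: bigcap_inf].
  move=> w [_ [pw [Aw Fw]]] m _; have [n kn Fn] := Fw m.+1%:R.
  exists (n - k)%N => //; split=> //; apply: hit_eventually => //.
  by rewrite subnKC.
have aebad : {ae P, forall w (k : nat) (j : nat), forall h, unpickle j = Some h ->
    ~ bad k (history h).1 (history h).2 w}.
  apply: ae_foralln => k; apply: ae_foralln => j.
  case: unpickle => [h|]; last by apply: aeW => w h.
  apply: negligibleS (bad0 k (history h).1 (history h).2) => w /=.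
  by move=> /existsNP[h' /not_implyP[[->] /contrapT]].
apply: filterS2 ae_reachable aebad => w rw nbad [k _ Ak].
apply: contrapT => unb.
have pw := @past_history k w.
apply: (nbad k (pickle (mkseq (fun i => (V i w, B i w)) k)) _ (pickleK _)).
split; first by rewrite -(random_graph_past pw).
split=> //; split=> // L; apply: contrapT => nL; apply: unb; exists L, k => // n kn /=.
by rewrite leNgt; apply/negP => /ltW Ln; apply: nL; exists n.
Qed.

End supermartingale.

(** * Vertices of high degree *)

Definition degree_tail (k : nat) (g : lgraph) : nat :=
  count (fun z => k <= degree g z)%N (vertices g).

Lemma degree_tail0 g : degree_tail 0 g = nvertices g.
Proof. by rewrite /degree_tail (eq_count (a2 := predT)) // count_predT size_vertices. Qed.

Lemma degree_tail_split k g :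
  degree_tail k g = (count (fun z => degree g z == k) (vertices g) + degree_tail k.+1 g)%N.
Proof.
rewrite /degree_tail -count_predUI -[LHS]addn0; congr (_ + _)%N.
  by apply: eq_count => z /=; rewrite leq_eqVlt eq_sym.
apply/esym/count_eq0 => z _ /=.
by case: eqVneq => // ->; rewrite ltnn.
Qed.

(** If x has degree above k, only the new vertex joins the vertices of degree above k. At degree
    exactly k the whole clique of size k + 1 joins together with it, which gives k + 2. *)
Lemma degree_tail_duplicate k g x : clique_graph g -> x \in vertices g ->
  (degree_tail k.+1 g + (k < degree g x) + (degree g x == k) * k.+2 <=
   degree_tail k.+1 (duplicate g x))%N.
Proof.
move=> gc xg; have [gS _ _] := gc.
rewrite /degree_tail vertices_duplicate -cats1 count_cat /= addn0 degree_duplicate_new//.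
have /eq_in_count-> : {in vertices g, (fun z => k < degree (duplicate g x) z)%N =1
    (fun z => k < degree g z + same_clique g x z)%N}.
  by move=> z zg /=; rewrite degree_duplicate_old.
rewrite ltnS; case: (ltngtP k (degree g x)) => kx; rewrite ?mul0n ?mul1n ?addn0 /=.
- rewrite leq_add2r; apply: sub_count => z /= kz; exact: leq_trans kz (leq_addr _ _).
- by apply: sub_count => z /= kz; exact: leq_trans kz (leq_addr _ _).
rewrite addn1 addnS ltnS [X in (_ + X <= _)%N](_ : _ = count (same_clique g x) (vertices g)).
  rewrite -count_predUI.
  rewrite [X in (_ + X)%N](_ : _ = 0%N) ?addn0.
    apply: sub_count => z /= /orP[kz|xz]; first exact: leq_trans kz (leq_addr _ _).
    by rewrite kx (degree_same_clique gc xg xz) xz addn1.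
  apply: count_eq0 => z _ /=.
  by apply/negP => /andP[kz xz]; move: kz; rewrite kx (degree_same_clique gc xg xz) ltnn.
by rewrite count_same_clique// -kx.
Qed.

(** If x has degree above k, only x drops out, since the rest of its clique loses one edge each. At
    degree exactly k the whole clique of size k + 1 drops out. The bound k + 1 serves both cases. *)
Lemma degree_tail_isolate k g x : clique_graph g -> x \in vertices g ->
  (degree_tail k g <= degree_tail k (isolate g x) + (k <= degree g x) * k.+1)%N.
Proof.
move=> gc xg; have [gS _ _] := gc.
rewrite /degree_tail vertices_isolate.
case: (ltngtP k (degree g x)) => kx; rewrite ?mul0n ?mul1n ?addn0.
- apply: (@leq_trans (count (fun z => k <= degree (isolate g x) z)%N (vertices g) +
                     count (pred1 x) (vertices g))); last first.
    by rewrite leq_add2l count_uniq_mem ?uniq_vertices// xg.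
  rewrite -count_predUI; apply: leq_trans (leq_addr _ _); apply: leq_in_count => z zg /= kz.
  rewrite degree_isolate//; case: eqVneq => [|zx] /=; first by rewrite orbT.
  case: (boolP (adj g x z)) => xz; last by rewrite subn0 kz.
  have := @degree_same_clique g x z gc xg; rewrite /same_clique xz orbT => /(_ isT) <-.
  by rewrite orbF subn1 -ltnS prednK// (leq_trans _ kx).
- apply: leq_in_count => z zg /= kz; rewrite degree_isolate//.
  have xz : same_clique g x z = false.
    by apply/negP => /(degree_same_clique gc xg) E; move: kz; rewrite -E leqNgt kx.
  by move: xz; rewrite /same_clique eq_sym => /norP[/negPf-> /negPf->]; rewrite subn0.
rewrite [X in (_ + X)%N](_ : _ = count (same_clique g x) (vertices g)); last first.
  by rewrite count_same_clique// -kx.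
rewrite -count_predUI; apply: leq_trans (leq_addr _ _).
apply: leq_in_count => z zg /= kz; case: (boolP (same_clique g x z)) => [|xz]; rewrite ?orbT//.
rewrite orbF degree_isolate//; move: xz; rewrite /same_clique eq_sym.
by move=> /norP[/negPf-> /negPf->]; rewrite subn0.
Qed.

Lemma sumr_count (R : pzSemiRingType) (T : Type) (a : pred T) (s : seq T) :
  \sum_(x <- s) (a x)%:R = (count a s)%:R :> R.
Proof. by elim: s => [|x s IHs]; rewrite ?big_nil// big_cons IHs /= natrD. Qed.

Lemma sqr_max0_le (R : realFieldType) (z z' c : R) : z' <= z + c ->
  Num.max z' 0 ^+ 2 <= Num.max z 0 ^+ 2 + 2 * Num.max z 0 * c + c ^+ 2.
Proof.
move=> zz'; rewrite [leRHS](_ : _ = (Num.max z 0 + c) ^+ 2); last by ring.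
have [z'0|z'0] := leP z' 0; first by rewrite expr0n/= sqr_ge0.
rewrite lerXn2r// ?nnegrE; first by exact: ltW.
  by apply: (le_trans (ltW z'0)); apply: (le_trans zz'); rewrite lerD2r le_max lexx.
by apply: (le_trans zz'); rewrite lerD2r le_max lexx.
Qed.

(** * Drift of the squared positive deficits *)

Section degree_tail_deficit.
Variables (R : realType) (theta : R).
Hypotheses (theta_gt0 : 0 < theta) (theta_lt1 : theta < 1).

(** The shortfall of W_k from its equilibrium value in the overview. *)
Definition deficit (k : nat) (g : lgraph) : R :=
  theta ^+ k * (nvertices g)%:R - (degree_tail k g)%:R.

Definition pos_deficit (k : nat) (g : lgraph) : R := Num.max (deficit k g) 0.

Lemma pos_deficit_ge0 k g : 0 <= pos_deficit k g.
Proof. by rewrite le_max lexx orbT. Qed.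

Lemma pos_deficit0 g : pos_deficit 0 g = 0.
Proof. by rewrite /pos_deficit /deficit degree_tail0 expr0 mul1r subrr maxxx. Qed.

Lemma pos_deficit_le k g : pos_deficit k g <= (nvertices g)%:R.
Proof.
rewrite ge_max ler0n andbT lerBlDr; apply: (@le_trans _ _ (nvertices g)%:R).
  by rewrite ler_piMl// exprn_ile1// ltW.
by rewrite lerDl.
Qed.

Let theta_exp_le1 k : 0 <= theta ^+ k <= 1.
Proof. by rewrite exprn_ge0 ?exprn_ile1//= ltW. Qed.

Lemma sum_pos_deficit_sqr k g : clique_graph g ->
  \sum_(x <- vertices g) (theta * pos_deficit k.+1 (duplicate g x) ^+ 2 +
                          (1 - theta) * pos_deficit k.+1 (isolate g x) ^+ 2) <=
  (nvertices g)%:R * pos_deficit k.+1 g ^+ 2 +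
  2 * pos_deficit k.+1 g *
    (theta * deficit k.+1 g + k.+2%:R * (theta * deficit k g - deficit k.+1 g)) +
  (nvertices g)%:R * k.+2%:R ^+ 2.
Proof.
move=> gc; set p := pos_deficit k.+1 g; set N := (nvertices g)%:R : R.
(* [cdup] and [ciso] bound the increments of the deficit under the two moves from above; both are at
   most k + 2 in absolute value, which gives the quadratic error. *)
pose cdup x : R := theta ^+ k.+1 - (k < degree g x)%:R - (degree g x == k)%:R * k.+2%:R.
pose ciso x : R := (k < degree g x)%:R * k.+2%:R.
have dupE x : x \in vertices g -> pos_deficit k.+1 (duplicate g x) ^+ 2 <=
    p ^+ 2 + 2 * p * cdup x + k.+2%:R ^+ 2.
  move=> xg; apply: (@le_trans _ _ (p ^+ 2 + 2 * p * cdup x + cdup x ^+ 2)).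
    apply: sqr_max0_le; rewrite /deficit /cdup /= -natr1.
    have := degree_tail_duplicate k gc xg; rewrite -(ler_nat R) !natrD natrM; lra.
  rewrite lerD2l -subr_ge0 subr_sqr; have /andP[t0 t1] := theta_exp_le1 k.+1.
  have k2 : 2 <= k.+2%:R :> R by rewrite ler_nat.
  by rewrite mulr_ge0 /cdup//; case: (ltngtP k (degree g x)) => _ /=; lra.
have isoE x : x \in vertices g -> pos_deficit k.+1 (isolate g x) ^+ 2 <=
    p ^+ 2 + 2 * p * ciso x + k.+2%:R ^+ 2.
  move=> xg; apply: (@le_trans _ _ (p ^+ 2 + 2 * p * ciso x + ciso x ^+ 2)).
    apply: sqr_max0_le; rewrite /deficit /ciso /=.
    have := degree_tail_isolate k.+1 gc xg; rewrite -(ler_nat R) !natrD natrM; lra.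
  by rewrite lerD2l /ciso; case: (k < _)%N; rewrite ?mul1r// mul0r expr0n sqr_ge0.
(* The number of vertices of degree exactly k is the difference of two consecutive tails, so the
   drift becomes linear in the deficits. *)
have sumc : \sum_(x <- vertices g) (theta * cdup x + (1 - theta) * ciso x) =
    theta * deficit k.+1 g + k.+2%:R * (theta * deficit k g - deficit k.+1 g).
  transitivity (theta ^+ k.+2 * N - theta * (degree_tail k.+1 g)%:R -
     theta * k.+2%:R * (count (fun x => degree g x == k) (vertices g))%:R +
     (1 - theta) * k.+2%:R * (degree_tail k.+1 g)%:R); last first.
    rewrite /deficit (degree_tail_split k) natrD -/N !exprS; ring.
  rewrite /N -(size_vertices g) -count_predT -!sumr_count !mulr_sumr.
  rewrite -!sumrB -big_split /=; apply: eq_bigr => x _.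
  by rewrite /cdup /ciso !exprS /=; ring.
apply: (@le_trans _ _ (\sum_(x <- vertices g) ((p ^+ 2 + k.+2%:R ^+ 2) * (predT x)%:R +
    2 * p * (theta * cdup x + (1 - theta) * ciso x)))).
  rewrite big_seq_cond [leRHS]big_seq_cond; apply: ler_sum => x /andP[xg _].
  have := ler_wpM2l (ltW theta_gt0) (dupE x xg).
  have t1 : 0 <= 1 - theta by rewrite subr_ge0 ltW.
  have := ler_wpM2l t1 (isoE x xg) => /[swap] H1 H2.
  apply: le_trans (lerD H1 H2) _; rewrite le_eqVlt; apply/orP; left; apply/eqP => /=; ring.
rewrite big_split -!mulr_sumr sumr_count count_predT size_vertices sumc -/N.
by rewrite le_eqVlt; apply/orP; left; apply/eqP => /=; ring.
Qed.

(** Replacing the deficit at level k by its positive part only increases the cross term, and 2 p q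
    <= p^2 + q^2 decouples the two levels. *)
Lemma sum_pos_deficit_sqr_le k g : clique_graph g ->
  \sum_(x <- vertices g) (theta * pos_deficit k.+1 (duplicate g x) ^+ 2 +
                          (1 - theta) * pos_deficit k.+1 (isolate g x) ^+ 2) <=
  (nvertices g)%:R * pos_deficit k.+1 g ^+ 2 +
  ((2 * theta - k.+2%:R * (2 - theta)) * pos_deficit k.+1 g ^+ 2 +
    theta * k.+2%:R * pos_deficit k g ^+ 2) +
  (nvertices g)%:R * k.+2%:R ^+ 2.
Proof.
move=> /(sum_pos_deficit_sqr k)/le_trans; apply; rewrite lerD2r lerD2l.
set p := pos_deficit k.+1 g; set q := pos_deficit k g.
have p0 : 0 <= p := pos_deficit_ge0 _ _.
have pE : p * deficit k.+1 g = p ^+ 2.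
  rewrite /p /pos_deficit; case: (leP (deficit k.+1 g) 0) => [_|]; last by rewrite expr2.
  by rewrite mul0r expr0n.
have qE : deficit k g <= q by rewrite le_max lexx.
have pq : p * deficit k g <= p * q by rewrite ler_wpM2l.
have [pq2 k2] : 2 * (p * q) <= p ^+ 2 + q ^+ 2 /\ 0 <= theta * k.+2%:R.
  by split; [have := sqr_ge0 (p - q); rewrite sqrrB -mulr_natl; lra|rewrite mulr_ge0// ltW].
rewrite [leLHS](_ : _ = 2 * theta * (p * deficit k.+1 g) +
   2 * (theta * k.+2%:R) * (p * deficit k g) - 2 * k.+2%:R * (p * deficit k.+1 g)); last by ring.
rewrite pE; have := ler_wpM2l k2 pq; have := ler_wpM2l k2 pq2; nra.
Qed.

End degree_tail_deficit.

Lemma sum_vertices_const (R : pzSemiRingType) (g : lgraph) (c : R) :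
  \sum_(x <- vertices g) c = (nvertices g)%:R * c.
Proof. by rewrite big_const_seq count_predT size_vertices iter_addr_0 mulr_natl. Qed.

Section step_mean.
Variables (R : realType) (theta : R).

Lemma step_mean_affine (f : lgraph -> R) (a c : R) g : (0 < nvertices g)%N ->
  step_mean theta (fun h => f h * a + c) g = step_mean theta f g * a + c.
Proof.
move=> g0; rewrite /step_mean.
rewrite (eq_bigr (fun x => (theta * f (duplicate g x) + (1 - theta) * f (isolate g x)) * a + c)).
  rewrite big_split /= sum_vertices_const -mulr_suml mulrDl mulrAC; congr (_ + _).
  by rewrite mulrAC divff ?mul1r// pnatr_eq0 -lt0n.
by move=> x _; ring.
Qed.

Lemma step_mean_le (f : lgraph -> R) (c : R) g : (0 < nvertices g)%N ->
  \sum_(x <- vertices g) (theta * f (duplicate g x) + (1 - theta) * f (isolate g x)) <=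
  (nvertices g)%:R * c -> step_mean theta f g <= c.
Proof. by move=> g0 H; rewrite ler_pdivrMr ?ltr0n// mulrC. Qed.

End step_mean.

(** * The weighted energy and its bounded drift *)

Section tail_energy.
Variables (R : realType) (theta : R).
Hypotheses (theta_gt0 : 0 < theta) (theta_lt1 : theta < 1).

(** The factor 1 / 4 absorbs the quadratic errors, as (k + 2)^2 <= 4^(k + 1), and leaves the
    summable weights (1 - theta)^(k + 1). *)
Let w : R := (1 - theta) / 4.
Let w_ge0 : 0 <= w.
Proof. by rewrite divr_ge0// subr_ge0 ltW. Qed.

Definition tail_energy (n : nat) (g : lgraph) : R :=
  \sum_(k < n) ((1 - theta) / 4) ^+ k.+1 * pos_deficit theta k.+1 g ^+ 2.

Lemma tail_energy_ge0 n g : 0 <= tail_energy n g.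
Proof. by apply: sumr_ge0 => k _; rewrite mulr_ge0 ?sqr_ge0 ?exprn_ge0. Qed.

Let weight_le k : w ^+ k.+1 * k.+2%:R ^+ 2 <= (1 - theta) ^+ k.+1.
Proof.
rewrite /w expr_div_n -mulrA ler_piMr ?exprn_ge0 ?subr_ge0 ?(ltW theta_lt1)//.
rewrite mulrC ler_pdivrMr ?exprn_gt0// mul1r -!natrX ler_nat.
by rewrite -[4%N]/(2 ^ 2)%N -expnM mulnC expnM leq_exp2r// ltn_expl.
Qed.

Let geometric_le n : \sum_(k < n) (1 - theta) ^+ k.+1 <= theta^-1.
Proof.
rewrite -[leRHS]mul1r ler_pdivlMr//.
suff E : (\sum_(k < n) (1 - theta) ^+ k.+1) * theta = (1 - theta) - (1 - theta) ^+ n.+1.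
  have : 0 <= (1 - theta) ^+ n.+1 by rewrite exprn_ge0// subr_ge0 ltW.
  by rewrite E -addrA gerDl -opprD oppr_le0 => ?; rewrite addr_ge0// ltW.
elim: n => [|n IHn]; first by rewrite big_ord0 mul0r expr1 subrr.
by rewrite big_ord_recr mulrDl IHn /= [in RHS]exprS; ring.
Qed.

(* the cross terms cancel because the weights decay at rate w <= 1 - theta *)
Let sum_cross_le n g :
  \sum_(k < n) w ^+ k.+1 *
    ((2 * theta - k.+2%:R * (2 - theta)) * pos_deficit theta k.+1 g ^+ 2 +
     theta * k.+2%:R * pos_deficit theta k g ^+ 2) +
  w ^+ n.+1 * (theta * n.+2%:R * pos_deficit theta n g ^+ 2) <= 0.
Proof.
elim: n => [|n IHn].
  by rewrite big_ord0 pos_deficit0 expr0n/= !mulr0 addr0.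
rewrite big_ord_recr /=; set S := \sum_(i < n) _ in IHn *.
set p := pos_deficit theta n.+1 g ^+ 2; set q := pos_deficit theta n g ^+ 2 in IHn *.
(* The extra summand of the statement is the cross term that the next level will add. The negative
   coefficient that level n + 1 has on its own outweighs it, so the induction closes. *)
have H : w ^+ n.+1 * (p * (2 * theta - n.+2%:R * (2 - theta) + w * (theta * n.+3%:R))) <= 0.
  apply: mulr_ge0_le0; first exact: exprn_ge0.
  apply: mulr_ge0_le0; first exact: sqr_ge0.
  rewrite /w -[n.+3%:R]natr1 -[n.+2%:R]natr1 -[n.+1%:R]natr1.
  move: (n%:R : R) (ler0n R n) => x x0.
  have h0 : 0 <= (1 - theta) * theta by rewrite mulr_ge0 ?subr_ge0 // ltW.
  have h1 : 0 <= (1 - theta) * (1 - theta) by rewrite -expr2 sqr_ge0.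
  have : 0 <= x * ((2 - theta) - (1 - theta) * theta / 4) by rewrite mulr_ge0//; nra.
  nra.
apply: le_trans (_ : _ <= 0 + 0) _; last by rewrite addr0.
apply: le_trans (lerD IHn H); rewrite [w ^+ n.+2]exprS.
by rewrite le_eqVlt; apply/orP; left; apply/eqP; ring.
Qed.

Lemma sum_tail_energy n g : clique_graph g ->
  \sum_(x <- vertices g) (theta * tail_energy n (duplicate g x) +
                          (1 - theta) * tail_energy n (isolate g x)) <=
  (nvertices g)%:R * (tail_energy n g + \sum_(k < n) (1 - theta) ^+ k.+1).
Proof.
move=> gc; rewrite (eq_bigr (fun x => \sum_(k < n) w ^+ k.+1 *
    (theta * pos_deficit theta k.+1 (duplicate g x) ^+ 2 +
     (1 - theta) * pos_deficit theta k.+1 (isolate g x) ^+ 2))); last first.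
  by move=> x _; rewrite !mulr_sumr -big_split /=; apply: eq_bigr => k _; ring.
rewrite exchange_big /=.
pose D k := (2 * theta - k.+2%:R * (2 - theta)) * pos_deficit theta k.+1 g ^+ 2 +
     theta * k.+2%:R * pos_deficit theta k g ^+ 2.
apply: (@le_trans _ _ (\sum_(k < n)
   ((nvertices g)%:R * (w ^+ k.+1 * pos_deficit theta k.+1 g ^+ 2)
    + w ^+ k.+1 * D k + (nvertices g)%:R * (1 - theta) ^+ k.+1))).
  apply: ler_sum => k _; rewrite -mulr_sumr.
  have := ler_wpM2l (exprn_ge0 k.+1 w_ge0) (sum_pos_deficit_sqr_le theta_gt0 theta_lt1 k gc).
  move=> /le_trans; apply.
  have := ler_wpM2l (ler0n R (nvertices g)) (weight_le k); rewrite -/(D k) !mulrDr; lra.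
rewrite !big_split /= -!mulr_sumr mulrDr lerD2r gerDl.
have := sum_cross_le n g; rewrite -/D.
have : 0 <= w ^+ n.+1 * (theta * n.+2%:R * pos_deficit theta n g ^+ 2).
  by rewrite mulr_ge0 ?exprn_ge0// mulr_ge0 ?sqr_ge0// mulr_ge0// ltW.
rewrite /D; lra.
Qed.

(** With at most n + 1 vertices after n steps, the levels up to n + 1 reach one above any possible
    degree. The second summand is the squared deviation of N from its mean 1 + theta n. *)
Definition energy (n : nat) (g : lgraph) : R :=
  tail_energy n.+1 g + ((nvertices g)%:R - 1 - theta * n%:R) ^+ 2.

Lemma energy_ge0 n g : 0 <= energy n g.
Proof. by rewrite addr_ge0 ?tail_energy_ge0 ?sqr_ge0. Qed.

Lemma step_mean_energy n g : reachable n g ->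
  step_mean theta (energy n.+1) g <= energy n g + (theta^-1 + 1).
Proof.
move=> gr; have [gc gn] := gr; have [_ _ g0] := gc.
apply: step_mean_le => //.
(* Level n + 2 enters only at time n + 1. Its positive deficit is at most the number of vertices, so
   it costs one more term of the geometric series. *)
pose last x := w ^+ n.+2 * (theta * pos_deficit theta n.+2 (duplicate g x) ^+ 2 +
                            (1 - theta) * pos_deficit theta n.+2 (isolate g x) ^+ 2).
(* The squared deviation grows on average by theta (1 - theta), the variance of one coin. *)
pose dev : R := (nvertices g)%:R - 1 - theta * n%:R.
rewrite (eq_bigr (fun x => (theta * tail_energy n.+1 (duplicate g x) +
     (1 - theta) * tail_energy n.+1 (isolate g x)) + last x + (dev ^+ 2 + theta * (1 - theta)))).
  rewrite big_split big_split /= sum_vertices_const.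
  have lastle : \sum_(x <- vertices g) last x <= (nvertices g)%:R * (1 - theta) ^+ n.+2.
    rewrite -sum_vertices_const big_seq_cond [leRHS]big_seq_cond.
    apply: ler_sum => x /andP[xg _]; apply: le_trans (weight_le _).
    rewrite ler_wpM2l ?exprn_ge0//.
    have pn b : pos_deficit theta n.+2 (if b then duplicate g x else isolate g x) ^+ 2 <=
        n.+3%:R ^+ 2.
      rewrite lerXn2r ?nnegrE ?pos_deficit_ge0//.
      apply: (le_trans (pos_deficit_le theta_gt0 theta_lt1 _ _)); rewrite ler_nat.
      by have [_ /leq_trans] := reachable_step b gr xg; apply.
    have := pn true; have := pn false; have := theta_gt0; have := theta_lt1; nra.
  have := sum_tail_energy n.+1 gc; have := geometric_le n.+2.
  rewrite big_ord_recr /= => geo te.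
  have N0 : 0 <= (nvertices g)%:R :> R by [].
  have Ngeo := ler_wpM2l N0 geo.
  have Nvar : (nvertices g)%:R * (theta * (1 - theta)) <= (nvertices g)%:R.
    by rewrite ler_piMr//; nra.
  rewrite /energy -/dev; set Sd := \sum_(x <- _) last x in lastle *.
  set A := \sum_(x <- _) _ in te *.
  set S := \sum_(k < n.+1) _ in te Ngeo.
  rewrite !(mulrDr (nvertices g)%:R) mulr1 in te Ngeo *.
  move: lastle te Ngeo Nvar.
  move: A Sd ((nvertices g)%:R * (1 - theta) ^+ n.+2) ((nvertices g)%:R * S)
    ((nvertices g)%:R * dev ^+ 2) => A Sd X Y Z; lra.
move=> x _; rewrite /energy /tail_energy !big_ord_recr /= -/w /last /dev -!natr1; ring.
Qed.

End tail_energy.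

Lemma degree_le_max g z : z \in vertices g -> (degree g z <= max_degree g)%N.
Proof. by move=> zg; rewrite /max_degree; apply: (@leq_bigmax_seq _ _ _ (degree g)). Qed.

Lemma degree_tail_gt_max k g : (max_degree g < k)%N -> degree_tail k g = 0%N.
Proof.
move=> mk; apply: count_eq0 => z zg.
by rewrite -ltnNge; apply: leq_ltn_trans mk; exact: degree_le_max.
Qed.

Lemma max_degree_lt_nvertices g : clique_graph g -> (max_degree g < nvertices g)%N.
Proof.
move=> [gS _ g0]; rewrite -(prednK g0) ltnS; apply/bigmax_leqP_seq => z zg _.
by rewrite -ltnS (prednK g0) degree_lt_nvertices.
Qed.

Lemma near_le_sqrt (R : realType) (K : R) :
  \forall n \near \oo, K <= Num.sqrt n.+1%:R.
Proof.
exists (Num.truncn (K ^+ 2)) => // n /= Kn.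
have [K0|/ltW K0] := leP K 0; first exact: le_trans (sqrtr_ge0 _).
rewrite -(ger0_norm K0) -sqrtr_sqr ler_wsqrtr// ltW// (lt_le_trans (truncnS_gt _))//.
by rewrite ler_nat ltnS.
Qed.

(** * Linear growth of the vertex set, logarithmic growth of the maximal degree *)

Section growth.
Context (d : measure_display) (Omega : measurableType d) (R : realType).
Variables (P : probability Omega R) (theta : R).
Variables (V : nat -> {mfun Omega >-> nat}) (B : nat -> {mfun Omega >-> bool}).
Hypotheses (theta_gt0 : 0 < theta) (theta_lt1 : theta < 1).
Hypothesis VB : duplication_deletion P theta V B.

Local Notation G := (random_graph V B).

(** With a = sqrt (n + 1), the sum H / a^3 + 2 C / a is a nonnegative supermartingale: the drift C
    costs C / a^3 per step, which the decrease of 2 C / a pays for. *)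
Lemma ae_three_halves_growth (H : nat -> lgraph -> R) (C : R) : 0 <= C ->
  (forall n g, 0 <= H n g) ->
  (forall n g, reachable n g -> step_mean theta (H n.+1) g <= H n g + C) ->
  {ae P, forall w, exists L, \forall n \near \oo,
    H n (G n w) <= L * Num.sqrt n.+1%:R ^+ 3}.
Proof.
move=> C0 H0 Hstep; pose a n : R := Num.sqrt n.+1%:R.
have a_gt0 n : 0 < a n by rewrite sqrtr_gt0.
have a2 n : a n ^+ 2 = n.+1%:R by rewrite sqr_sqrtr.
pose F n g := H n g * (a n ^- 3) + 2 * C / a n.
have F_ge0 n g : reachable n g -> 0 <= F n g.
  move=> _; have an0 := ltW (a_gt0 n).
  by rewrite addr_ge0 ?divr_ge0 ?mulr_ge0 ?exprn_ge0.
have F_step n g : reachable n g -> True -> step_mean theta (F n.+1) g <= F n g.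
  move=> gr _; have [[_ _ g0] _] := gr.
  rewrite step_mean_affine// /F.
  have aa : a n <= a n.+1 by rewrite ler_wsqrtr// ler_nat.
  have gap : C * a n.+1 ^- 3 <= 2 * C / a n - 2 * C / a n.+1.
    have -> : 2 * C / a n - 2 * C / a n.+1 =
        2 * C * ((a n.+1 - a n) * (a n.+1 + a n)) / (a n * a n.+1 * (a n.+1 + a n)).
      by field; rewrite !gt_eqF ?addr_gt0.
    rewrite -subr_sqr !a2 -[n.+2%:R]natr1 addrAC subrr add0r mulr1 [2 * C]mulrC -[leRHS]mulrA.
    apply: ler_wpM2l => //.
    rewrite ler_pdivlMr ?mulr_gt0 ?addr_gt0// mulrC ler_pdivrMr ?exprn_gt0//.
    move: (a_gt0 n) (a_gt0 n.+1) aa; move: (a n) (a n.+1) => x y x0 y0 xy.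
    rewrite -subr_ge0 (_ : _ - _ = y * ((y - x) * (2 * y + x))); last by ring.
    apply: mulr_ge0; first exact: ltW.
    by apply: mulr_ge0; [rewrite subr_ge0|lra].
  have le3 : a n.+1 ^- 3 <= a n ^- 3.
    by rewrite lef_pV2 ?posrE ?exprn_gt0// lerXn2r// nnegrE ltW.
  have h1 : step_mean theta (H n.+1) g * a n.+1 ^- 3 <= (H n g + C) * a n.+1 ^- 3.
    by rewrite ler_wpM2r ?Hstep// invr_ge0 exprn_ge0// ltW.
  have h2 : H n g * a n.+1 ^- 3 <= H n g * a n ^- 3 by rewrite ler_wpM2l.
  by rewrite mulrDl in h1; lra.
have := ae_bounded (A := fun _ _ => True) VB F_ge0 F_step.
apply: filterS => w /(_ (nearW _ _))[//|].
move=> L [k _ FL]; exists L; exists k => // n /= kn.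
rewrite -ler_pdivrMr ?exprn_gt0//; apply: le_trans (FL n kn).
by rewrite lerDl divr_ge0 ?mulr_ge0// ltW.
Qed.

Lemma ae_energy_le : {ae P, forall w, exists L, \forall n \near \oo,
  energy theta n (G n w) <= L * Num.sqrt n.+1%:R ^+ 3}.
Proof.
apply: (@ae_three_halves_growth _ (theta^-1 + 1)).
- by rewrite addr_ge0// invr_ge0 ltW.
- by move=> n g; exact: energy_ge0.
- by move=> n g; exact: step_mean_energy.
Qed.

Lemma ae_nvertices_ge : {ae P, forall w, \forall n \near \oo,
  theta / 2 * n.+1%:R <= (nvertices (G n w))%:R :> R}.
Proof.
apply: filterS ae_energy_le => w [L EL]; near=> n.
set N : R := (nvertices _)%:R; pose s : R := Num.sqrt n.+1%:R.
have s_gt0 : 0 < s by rewrite sqrtr_gt0.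
have s2 : s ^+ 2 = n.+1%:R by rewrite sqr_sqrtr.
have En : (N - 1 - theta * n%:R) ^+ 2 <= L * s ^+ 3.
  by apply: le_trans (near EL n _); rewrite // lerDr tail_energy_ge0.
(* From this threshold on, the square of theta s^2 / 2 is at least L s^3. *)
have Ls : 4 * L / theta ^+ 2 <= s by rewrite /s; near: n; exact: near_le_sqrt.
rewrite leNgt; apply/negP => Nlt.
have dev : theta / 2 * s ^+ 2 < 1 + theta * n%:R - N.
  have {}Nlt : N < theta / 2 * (n%:R + 1) by rewrite natr1.
  by rewrite s2 -[n.+1%:R]natr1; have := theta_lt1; lra.
have dev2 : (theta / 2 * s ^+ 2) ^+ 2 < (N - 1 - theta * n%:R) ^+ 2.
  rewrite -[ltRHS]sqrrN; apply: ltrXn2r => //; rewrite ?nnegrE.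
  - by rewrite mulr_ge0 ?exprn_ge0 ?divr_ge0 ?ltW.
  - have : 0 <= theta / 2 * s ^+ 2 by rewrite mulr_ge0 ?exprn_ge0 ?divr_ge0 ?ltW.
    by move: dev; lra.
have := lt_le_trans dev2 En; rewrite ltNge => /negP; apply.
rewrite ler_pdivrMr ?exprn_gt0// in Ls.
rewrite (_ : (_ * s ^+ 2) ^+ 2 = s ^+ 3 * (s * theta ^+ 2 / 4)); last by field.
by rewrite mulrC ler_wpM2l ?exprn_ge0 ?(ltW s_gt0)//; lra.
Unshelve. all: by end_near. Qed.

(** No vertex reaches degree m, one above the maximum, so the deficit at level m is the full theta^m
    N. Its weighted square is one summand of the energy, which forces sqrt (n + 1) <= K b^m. *)
Lemma ae_max_degree_ge : exists2 c : R, 0 < c & {ae P, forall w, \forall n \near \oo,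
  c * ln n.+3%:R <= (max_degree (G n w)).+1%:R}.
Proof.
(* 1 / b is the weight (1 - theta) / 4 times theta^2, the factor between the contributions of full
   deficits at consecutive levels. *)
pose b : R := 4 / ((1 - theta) * theta ^+ 2).
have b_gt1 : 1 < b.
  rewrite ltr_pdivlMr ?mulr_gt0 ?exprn_gt0 ?subr_gt0// mul1r.
  have : theta ^+ 2 <= 1 by rewrite exprn_ile1// ltW.
  have : 0 <= theta ^+ 2 by rewrite sqr_ge0.
  by have := theta_gt0; nra.
have lnb : 0 < ln b by rewrite ln_gt0.
(* A factor 2 is lost in absorbing [ln K], a factor 4 in comparing [ln n.+3%:R] with [ln s]. *)
exists ((8 * ln b)^-1); first by rewrite invr_gt0 mulr_gt0.
apply: filterS3 (ae_reachable VB) ae_nvertices_ge ae_energy_le => w gr Nw [L EL].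
pose L' : R := Num.max L 1.
have L'0 : 0 < L' by rewrite lt_max ltr01 orbT.
near=> n; set m := (max_degree _).+1.
pose s : R := Num.sqrt n.+1%:R.
have s_gt0 : 0 < s by rewrite sqrtr_gt0.
have [s0 t0] := (ltW s_gt0, ltW theta_gt0).
have t10 : 0 <= 1 - theta by rewrite subr_ge0 ltW.
have s2 : s ^+ 2 = n.+1%:R by rewrite sqr_sqrtr.
have Nn : theta / 2 * s ^+ 2 <= (nvertices (G n w))%:R.
  by rewrite s2; near: n.
have En : tail_energy theta n.+1 (G n w) <= L' * s ^+ 3.
  apply: le_trans (_ : energy theta n (G n w) <= _); first by rewrite lerDl sqr_ge0.
  apply: le_trans (near EL n _) _ => //.
  by rewrite ler_wpM2r ?exprn_ge0// le_max lexx.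
have [gc gn] := gr n.
have mn : (m <= n.+1)%N by apply: leq_trans gn; exact: max_degree_lt_nvertices.
have defm : pos_deficit theta m (G n w) = theta ^+ m * (nvertices (G n w))%:R.
  rewrite /pos_deficit /deficit degree_tail_gt_max// subr0 max_l//.
  by rewrite mulr_ge0 ?exprn_ge0.
have Em : ((1 - theta) / 4) ^+ m * (theta ^+ m * (theta / 2 * s ^+ 2)) ^+ 2 <= L' * s ^+ 3.
  apply: le_trans En.
  apply: (@le_trans _ _ (((1 - theta) / 4) ^+ m * pos_deficit theta m (G n w) ^+ 2)).
    rewrite ler_wpM2l ?exprn_ge0 ?divr_ge0 // defm lerXn2r ?nnegrE//.
    - by rewrite !mulr_ge0 ?exprn_ge0 ?divr_ge0 ?exprn_ge0.
    - by rewrite !mulr_ge0 ?exprn_ge0.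
    - by rewrite ler_wpM2l// exprn_ge0.
  rewrite /tail_energy (bigD1 (Ordinal mn)) //= lerDl; apply: sumr_ge0 => k _.
  by rewrite mulr_ge0 ?sqr_ge0 ?exprn_ge0 ?divr_ge0.
pose K : R := 4 * L' / theta ^+ 2.
have K_gt0 : 0 < K by rewrite divr_gt0 ?mulr_gt0 ?exprn_gt0.
have sb : s <= K * b ^+ m.
  have bV : b^-1 = (1 - theta) / 4 * theta ^+ 2 by rewrite /b invf_div mulrAC.
  have bm : ((1 - theta) / 4) ^+ m * (theta ^+ m) ^+ 2 = (b ^+ m)^-1.
    by rewrite -exprM mulnC exprM -exprMn -bV exprVn.
  have bm0 : 0 < b ^+ m by rewrite exprn_gt0// (lt_trans _ b_gt1).
  have : theta ^+ 2 / 4 * s ^+ 4 / b ^+ m <= L' * s ^+ 3.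
    by rewrite -bm; apply: le_trans Em; rewrite le_eqVlt; apply/orP; left; apply/eqP; field.
  rewrite ler_pdivrMr// => sbm.
  rewrite -(ler_pM2l (exprn_gt0 3 s_gt0)).
  have th : theta != 0 by rewrite gt_eqF.
  rewrite (_ : s ^+ 3 * s = theta ^+ 2 / 4 * s ^+ 4 * (4 / theta ^+ 2)); last by field.
  rewrite (_ : s ^+ 3 * _ = L' * s ^+ 3 * b ^+ m * (4 / theta ^+ 2)); last by rewrite /K; field.
  by rewrite ler_wpM2r// divr_ge0 ?exprn_ge0.
have b0 : 0 < b := lt_trans ltr01 b_gt1.
have lns : ln s <= ln K + m%:R * ln b.
  rewrite mulr_natl -lnXn// -lnM ?posrE ?exprn_gt0//.
  by rewrite ler_ln ?posrE// mulr_gt0// exprn_gt0.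
have lnK : 2 * ln K <= ln s.
  rewrite mulr_natl -lnXn// ler_ln ?posrE ?exprn_gt0//.
  by rewrite /s; near: n; exact: near_le_sqrt.
have ln3 : ln n.+3%:R <= 4 * ln s.
  rewrite mulr_natl -lnXn// ler_ln ?posrE ?exprn_gt0//.
  rewrite (exprM s 2 2) s2 -natrX ler_nat.
  have n0 : (0 < n)%N by near: n; exists 1%N.
  apply: (@leq_trans (2 * n.+1)%N).
    by rewrite mul2n -addnn addSn addnS !ltnS -add1n leq_add2r.
  by rewrite expnS expn1 leq_mul2r ltnS n0.
rewrite mulrC ler_pdivrMr ?mulr_gt0//; lra.
Unshelve. all: by end_near. Qed.

End growth.

(** * The degree of a fixed vertex relative to the maximal degree *)

Lemma exists_max_degree g : (0 < nvertices g)%N -> exists v, has_max_degree g v.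
Proof.
move=> g0; rewrite /has_max_degree /max_degree.
have : vertices g != [::] by rewrite -size_eq0 size_vertices -lt0n.
elim: (vertices g) => // x s IHs _; rewrite big_cons.
case: (eqVneq s [::]) => [->|/IHs[v /andP[vs /eqP vm]]].
  by exists x; rewrite inE eqxx big_nil maxn0 eqxx.
case: (leqP (\max_(v <- s) degree g v) (degree g x)) => mx.
  by exists x; rewrite inE eqxx /=.
by exists v; rewrite inE vs orbT vm /=.
Qed.

Lemma max_degree_duplicate g m z : clique_graph g -> has_max_degree g m ->
  z \in vertices g ->
  (max_degree g + same_clique g m z <= max_degree (duplicate g z))%N.
Proof.
move=> [gS _ _] /andP[mg /eqP <-] zg.
rewrite same_clique_sym// -degree_duplicate_old//; apply: degree_le_max.
by rewrite vertices_duplicate mem_rcons inE mg orbT.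
Qed.

(** The delicate case is the deletion of m itself: if m has a neighbour, that neighbour keeps a
    degree of one less. *)
Lemma max_degree_isolate g m z : clique_graph g -> has_max_degree g m ->
  z \in vertices g ->
  (max_degree g - same_clique g m z <= max_degree (isolate g z))%N.
Proof.
move=> gc mm zg; have [gS _ _] := gc; have /andP[mg /eqP mE] := mm.
have [gs gi gv] := gS.
case: (eqVneq m z) => [<-|mz]; last first.
  rewrite /same_clique (negPf mz) -mE gs.
  have := degree_isolate m gS zg; rewrite (negPf mz) => <-.
  exact: degree_le_max.
rewrite same_clique_refl -mE; case dm: (degree g m) => [//|k]; rewrite subn1 /=.
have : has (adj g m) (vertices g) by rewrite has_count -/(degree g m) dm.
case/hasP => u ug mu.
have um : u != m by apply: contraTneq mu => ->; rewrite gi.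
have du : degree (isolate g m) u = k.
  rewrite degree_isolate// (negPf um) mu -(degree_same_clique gc mg) ?dm ?subn1//.
  by rewrite /same_clique mu orbT.
by rewrite -{1}du; exact: degree_le_max.
Qed.

Section ratio.
Variable R : realType.

(** The quotient r of the overview for cliques of sizes x = a + 1 and y = b + 1. Summed over the x
    members of a clique, duplication raises x (x + 1) by exactly 2 x (x + 1), so growth rates cancel
    in the quotient. *)
Definition pronic_ratio (a b : nat) : R :=
  (a.+1%:R * a.+2%:R) / (b.+1%:R * b.+2%:R).

Definition hub_ratio (v : nat) (g : lgraph) : R :=
  pronic_ratio (degree g v) (max_degree g).

Lemma pronic_ratio_ge0 a b : 0 <= pronic_ratio a b.
Proof. by rewrite divr_ge0// mulr_ge0. Qed.

Lemma pronic_ratio_id a : pronic_ratio a a = 1.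
Proof. by rewrite /pronic_ratio divff// mulf_neq0// pnatr_eq0. Qed.

Lemma pronic_ratio_le a b a' b' : (a <= a')%N -> (b' <= b)%N ->
  pronic_ratio a b <= pronic_ratio a' b'.
Proof.
move=> aa bb; rewrite /pronic_ratio ler_pM ?invr_ge0 ?mulr_ge0//.
  by rewrite -!natrM ler_nat leq_mul.
by rewrite lef_pV2 ?posrE ?mulr_gt0// -!natrM ler_nat leq_mul.
Qed.

Lemma hub_ratio_duplicate v m g z : clique_graph g -> v \in vertices g ->
  has_max_degree g m -> z \in vertices g ->
  hub_ratio v (duplicate g z) <=
  pronic_ratio (degree g v + same_clique g v z)%N (max_degree g + same_clique g m z)%N.
Proof.
move=> gc vg mm zg; have [gS _ _] := gc; apply: pronic_ratio_le.
  by rewrite degree_duplicate_old// same_clique_sym.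
exact: max_degree_duplicate.
Qed.

Lemma hub_ratio_isolate v m g z : clique_graph g -> v \in vertices g ->
  has_max_degree g m -> z \in vertices g ->
  hub_ratio v (isolate g z) <=
  pronic_ratio (if z == v then 0 else degree g v - same_clique g v z)%N
               (max_degree g - same_clique g m z)%N.
Proof.
move=> gc vg mm zg; have [gS _ _] := gc; apply: pronic_ratio_le.
  rewrite degree_isolate// eq_sym; case: eqVneq => // zv.
  by rewrite /same_clique eq_sym (negPf zv) /=; have [-> _ _] := gS.
exact: max_degree_isolate.
Qed.

(* x and y are the sizes of the clique of v and of a largest clique disjoint
   from it; the left-hand side is N times the mean increment of the ratio. *)
Lemma ratio_drift_le (theta x y : R) (q : R -> R) : (forall t, q t = t * (t + 1)) ->
  0 < theta -> theta < 1 ->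
  1 <= x -> x + 1 <= y -> 24 <= (1 - theta) * (y - 1) ->
  theta * (x * (q (x + 1) / q y - q x / q y) + y * (q x / q (y + 1) - q x / q y)) +
  (1 - theta) * ((2 - 2 * x ^+ 2 - x * (x - 1)) / q y +
                 y * (q x / q (y - 1) - q x / q y)) <=
  - ((1 - theta) / 2 * (q x / q y)) + 40 / y ^+ 2.
Proof.
move=> qE t0 t1 x1 xy y24.
have y2 : 2 <= y by lra.
have qy : 0 < q y by rewrite qE; nra.
pose e := (y - 1)^-1.
have e0 : 0 < e by rewrite invr_gt0; lra.
have e1 : e * 24 <= 1 - theta by rewrite mulrC ler_pdivrMr//; lra.
pose T := theta * (2 * x * (x + 1) - 2 * q x * (y / (y + 2))) +
  (1 - theta) * (2 - 2 * x ^+ 2 - x * (x - 1) + 2 * q x * (y / (y - 1))).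
rewrite [leLHS](_ : _ = T / q y); last first.
  rewrite /T !qE; field.
  by rewrite !gt_eqF//; lra.
have ye : y / (y - 1) = 1 + e by rewrite /e; field; rewrite gt_eqF//; lra.
have ye2 : 1 - 2 * e <= y / (y + 2).
  rewrite (_ : y / (y + 2) = 1 - 2 / (y + 2)); last by field; rewrite gt_eqF//; lra.
  by rewrite lerD2l lerN2 ler_wpM2l// /e lef_pV2 ?posrE; lra.
have qx : 2 <= q x by rewrite qE; nra.
have T1 : T <= 4 * e * q x + (1 - theta) * (4 * x + 2 - q x).
  have h1 : 0 <= theta * q x * (y / (y + 2) - (1 - 2 * e)).
    by rewrite !mulr_ge0 ?subr_ge0//; lra.
  have h2 : 0 <= q x * e * (1 - theta) by rewrite !mulr_ge0//; lra.
  rewrite /T ye; move: (y / (y + 2)) h1 => Y; have := qE x; nra.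
(* The constant 24 makes the error 4 e q(x) at most a sixth of (1 - theta) q(x); the constant 40
   then absorbs the terms linear in x. *)
have T2 : T <= (1 - theta) * (40 - q x / 2).
  have h3 : 0 <= q x * (1 - theta - 24 * e) by rewrite mulr_ge0//; lra.
  have h4 : 0 <= (1 - theta) * (q x / 4 + 38 - 4 * x).
    by rewrite mulr_ge0//; [lra|rewrite qE; nra].
  apply: le_trans T1 _; have : 0 <= (1 - theta) * q x by rewrite mulr_ge0//; lra.
  nra.
apply: (@le_trans _ _ ((1 - theta) * (40 - q x / 2) / q y)).
  by rewrite ler_wpM2r// invr_ge0 ltW.
rewrite (_ : _ / q y = - ((1 - theta) / 2 * (q x / q y)) + (1 - theta) * 40 / q y); last by ring.
rewrite lerD2l; apply: ler_pM; rewrite ?invr_ge0 ?(ltW qy)//; [lra|lra|].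
by rewrite lef_pV2 ?posrE// ?exprn_gt0// ?qE; nra.
Qed.

End ratio.

Lemma sum_vertices_indic (R : pzSemiRingType) g v : v \in vertices g ->
  \sum_(z <- vertices g) (z == v)%:R = 1 :> R.
Proof. by move=> vg; rewrite sumr_count (count_uniq_mem v (uniq_vertices g)) vg. Qed.

(** * Contraction of the ratio in one step *)

Section ratio_step.
Variables (R : realType) (theta : R).
Hypotheses (theta_gt0 : 0 < theta) (theta_lt1 : theta < 1).

Local Notation sq := (@pronic_ratio R).

Let theta1_ge0 : 0 <= 1 - theta. Proof. by rewrite subr_ge0 ltW. Qed.

(** With v itself as the vertex of maximal degree to compare with, every move keeps the ratio at
    most 1. The drop comes from deleting v, as the maximal degree then falls by at most one. *)
Let sum_hub_ratio_max v g : clique_graph g -> has_max_degree g v ->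
  (0 < degree g v)%N ->
  \sum_(z <- vertices g) (theta * hub_ratio R v (duplicate g z) +
                          (1 - theta) * hub_ratio R v (isolate g z)) <=
  (nvertices g)%:R - (1 - theta) / 2 + 40 / (max_degree g).+1%:R ^+ 2.
Proof.
move=> gc vm d0; have /andP[vg /eqP dM] := vm.
apply: (@le_trans _ _ (\sum_(z <- vertices g)
    (1 + - ((1 - theta) * (1 - sq 0 (degree g v).-1)) * (z == v)%:R))).
  rewrite big_seq_cond [leRHS]big_seq_cond; apply: ler_sum => z /andP[zg _].
  have dup1 : hub_ratio R v (duplicate g z) <= 1.
    by apply: le_trans (hub_ratio_duplicate R gc vg vm zg) _; rewrite dM pronic_ratio_id.
  have iso1 : hub_ratio R v (isolate g z) <= 1 - (1 - sq 0 (degree g v).-1) * (z == v)%:R.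
    apply: le_trans (hub_ratio_isolate R gc vg vm zg) _; rewrite -dM.
    case: eqVneq => [->|_]; first by rewrite same_clique_refl subn1 mulr1 subKr.
    by rewrite pronic_ratio_id mulr0 subr0.
  have := ler_wpM2l (ltW theta_gt0) dup1; have := ler_wpM2l theta1_ge0 iso1; nra.
rewrite big_split /= sum_vertices_const mulr1 -mulr_sumr sum_vertices_indic// mulr1.
rewrite -addrA lerD2l -dM /pronic_ratio prednK//.
set y : R := (degree g v).+1%:R; set x : R := (degree g v)%:R.
have yx : y = x + 1 by rewrite /y -natr1.
have x1 : 1 <= x by rewrite ler1n.
have h : 2 / (x * y) <= 40 / y ^+ 2.
  rewrite ler_pdivrMr ?mulr_gt0 ?ltr0n// mulrAC ler_pdivlMr ?exprn_gt0 ?ltr0n//.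
  by rewrite yx; nra.
have y0 : 0 <= 40 / y ^+ 2 by rewrite divr_ge0 ?exprn_ge0.
have := ler_wpM2l theta1_ge0 h; have := mulr_ge0 (ltW theta_gt0) y0; have := theta1_ge0.
rewrite (mul1r 2%:R) -/x -/y; move: (40 / _) (2 / _) => Y X; lra.
Qed.

Let sum_hub_ratio_lt v g : clique_graph g -> v \in vertices g ->
  (degree g v < max_degree g)%N -> 24 <= (1 - theta) * (max_degree g)%:R ->
  \sum_(z <- vertices g) (theta * hub_ratio R v (duplicate g z) +
                          (1 - theta) * hub_ratio R v (isolate g z)) <=
  ((nvertices g)%:R - (1 - theta) / 2) * hub_ratio R v g +
  40 / (max_degree g).+1%:R ^+ 2.
Proof.
move=> gc vg dM M24; have [gS gt g0] := gc.
have [m mm] := exists_max_degree g0; have /andP[mg /eqP mM] := mm.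
(* Members of one clique share their degree, so a vertex m of maximal degree lies in a clique
   disjoint from that of v. *)
have disj z : same_clique g v z -> same_clique g m z = false.
  move=> vz; apply/negP => mz; move: dM.
  by rewrite -mM (degree_same_clique gc vg vz) (degree_same_clique gc mg mz) ltnn.
pose a := degree g v; pose b := max_degree g; pose r := sq a b.
pose dup z := r + (sq a.+1 b - r) * (same_clique g v z)%:R +
  (sq a b.+1 - r) * (same_clique g m z)%:R.
(* Deleting a member of the clique of v lowers the degree of v by one; the term with [z == v]
   corrects this to the reset to 0. *)
pose iso z := r + (sq a.-1 b - r) * (same_clique g v z)%:R +
  (sq 0 b - sq a.-1 b) * (z == v)%:R + (sq a b.-1 - r) * (same_clique g m z)%:R.
apply: (@le_trans _ _ (\sum_(z <- vertices g) (theta * dup z + (1 - theta) * iso z))).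
  rewrite big_seq_cond [leRHS]big_seq_cond; apply: ler_sum => z /andP[zg _].
  apply: lerD; apply: ler_wpM2l => //; first exact: ltW.
    apply: le_trans (hub_ratio_duplicate R gc vg mm zg) _; rewrite -/a -/b /dup -/r.
    case: (boolP (same_clique g v z)) => [/disj->|_]; last case: same_clique.
    - by rewrite !addn1 addn0 mulr1 mulr0 addr0 addrC subrK.
    - by rewrite addn0 addn1 mulr0 addr0 mulr1 addrC subrK.
    - by rewrite !addn0 !mulr0 !addr0.
  apply: le_trans (hub_ratio_isolate R gc vg mm zg) _; rewrite -/a -/b /iso -/r.
  case: eqVneq => [->|zv].
    by rewrite same_clique_refl disj ?same_clique_refl// subn0 /=; lra.
  case: (boolP (same_clique g v z)) => [/disj->|_]; last case: same_clique.
  - by rewrite subn0 subn1 /=; lra.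
  - by rewrite subn0 subn1 /=; lra.
  - by rewrite !subn0 /= -/r; lra.
have sumE : \sum_(z <- vertices g) (theta * dup z + (1 - theta) * iso z) =
  (nvertices g)%:R * r + (theta * (a.+1%:R * (sq a.+1 b - r) + b.+1%:R * (sq a b.+1 - r)) +
   (1 - theta) * (a.+1%:R * (sq a.-1 b - r) + (sq 0 b - sq a.-1 b) + b.+1%:R * (sq a b.-1 - r))).
  rewrite big_split /= -!mulr_sumr /dup /iso !big_split /= !sum_vertices_const -!mulr_sumr.
  rewrite !sumr_count !count_same_clique// -/a mM -/b count_uniq_mem ?uniq_vertices// vg.
  by rewrite /=; ring.
rewrite sumE -[hub_ratio R v g]/r [in leRHS]mulrBl -[leRHS]addrA lerD2l.
have b0 : (0 < b)%N by apply: leq_ltn_trans dM.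
pose q (t : R) := t * (t + 1).
have sqE i j : sq i j = q i.+1%:R / q j.+1%:R by rewrite /pronic_ratio /q !natr1.
set x : R := a.+1%:R; set y : R := b.+1%:R.
have x1 : 1 <= x by rewrite ler1n.
have xy : x + 1 <= y by rewrite natr1 ler_nat.
have yb : y - 1 = b%:R by rewrite /y -natr1 addrK.
have y24 : 24 <= (1 - theta) * (y - 1) by rewrite yb.
have qy : q y != 0 by rewrite /q mulf_neq0// ?natr1 pnatr_eq0.
have -> : sq a.+1 b = q (x + 1) / q y by rewrite sqE natr1.
have -> : sq a b.+1 = q x / q (y + 1) by rewrite sqE natr1.
have -> : sq a b.-1 = q x / q (y - 1) by rewrite sqE prednK// yb.
have -> : x * (sq a.-1 b - r) + (sq 0 b - sq a.-1 b) = (2 - 2 * x ^+ 2 - x * (x - 1)) / q y.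
  (* For a = 0 the truncated [a.-1] does not correspond to size x - 1, but both sides vanish. *)
  rewrite /r !sqE -/x -/y /x; case aE: a => [|k] /=.
    by rewrite !subrr mulr0 addr0 expr1n mulr1 subrr subr0 mul0r.
  by rewrite -[k.+2%:R]natr1; move: (q y) qy => Q Q0; rewrite /q; field.
have -> : r = q x / q y by rewrite /r sqE.
exact: ratio_drift_le.
Qed.

(** In the contraction factor N is replaced by its upper bound n + 1, which makes the factor
    deterministic. *)
Lemma step_mean_hub_ratio n v g : reachable n g -> v \in vertices g ->
  24 <= (1 - theta) * (max_degree g)%:R ->
  step_mean theta (hub_ratio R v) g <=
  hub_ratio R v g * (1 - (1 - theta) / 2 / n.+1%:R) +
  40 / (max_degree g).+1%:R ^+ 2 / (nvertices g)%:R.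
Proof.
move=> [gc gn] vg M24; have [_ _ g0] := gc.
have r0 : 0 <= hub_ratio R v g by exact: pronic_ratio_ge0.
have N0 : 0 < (nvertices g)%:R :> R by rewrite ltr0n.
have S : \sum_(z <- vertices g) (theta * hub_ratio R v (duplicate g z) +
                          (1 - theta) * hub_ratio R v (isolate g z)) <=
  ((nvertices g)%:R - (1 - theta) / 2) * hub_ratio R v g +
  40 / (max_degree g).+1%:R ^+ 2.
  have := degree_le_max vg; rewrite leq_eqVlt => /orP[/eqP dM|]; last first.
    by move=> ?; exact: sum_hub_ratio_lt.
  have -> : hub_ratio R v g = 1 by rewrite /hub_ratio dM pronic_ratio_id.
  rewrite mulr1; apply: sum_hub_ratio_max => //; first by rewrite /has_max_degree vg dM eqxx.
  rewrite dM lt0n; apply: contraTneq M24 => ->; rewrite mulr0 -ltNge ltr0n//.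
apply: step_mean_le => //; apply: le_trans S _.
rewrite mulrDr lerD//; last by rewrite mulrCA divff ?mulr1// gt_eqF.
rewrite [leLHS]mulrC [leRHS]mulrCA ler_wpM2l// mulrBr mulr1 lerD2l lerN2.
rewrite mulrCA ler_piMr ?divr_ge0 ?theta1_ge0//.
by rewrite ler_pdivrMr ?ltr0n// mul1r ler_nat.
Qed.

End ratio_step.

(** * Elementary estimates for the logarithm *)

Lemma ln_le_subr1 (R : realType) (x : R) : 0 < x -> ln x <= x - 1.
Proof. by move=> x0; have := expR_ge1Dx (ln x); rewrite lnK ?posrE// lerBrDl. Qed.

Lemma ln_succ_le (R : realType) (n : nat) :
  ln n.+2%:R - ln n.+1%:R <= n.+1%:R^-1 :> R.
Proof.
rewrite -ln_div ?posrE//; apply: le_trans (ln_le_subr1 _) _; first by rewrite divr_gt0.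
by rewrite -[n.+2%:R]natr1 mulrDl divff ?pnatr_eq0// mul1r addrAC subrr add0r.
Qed.

Lemma ln_succ_ge (R : realType) (n : nat) :
  n.+2%:R^-1 <= ln n.+2%:R - ln n.+1%:R :> R.
Proof.
rewrite -lerN2 opprB -ln_div ?posrE//.
apply: le_trans (ln_le_subr1 _) _; first by rewrite divr_gt0.
rewrite lerBlDr -[leRHS](@mulfK _ n.+2%:R) ?pnatr_eq0// ler_pM2r ?invr_gt0//.
by rewrite mulrDl mulNr mulVf ?pnatr_eq0// mul1r -[n.+2%:R]natr1 addrC addrK.
Qed.

Lemma near_le_nat (R : realType) (K : R) : \forall n \near \oo, K <= n.+1%:R.
Proof.
have := near_le_sqrt K; apply: filterS => n Kn; apply: (le_trans Kn).
by rewrite -[leRHS]sqr_sqrtr// expr2 ler_peMr ?sqrtr_ge0// -[leLHS]sqrtr1 ler_wsqrtr// ler1n.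
Qed.

Lemma near_le_ln (R : realType) (K : R) : \forall n \near \oo, K <= ln n.+1%:R.
Proof.
have := near_le_nat (expR K); apply: filterS => n Kn.
by rewrite -ler_expR lnK ?posrE.
Qed.

(** * Escape of the vertices of maximal degree *)

Section no_hub.
Context (d : measure_display) (Omega : measurableType d) (R : realType).
Variables (P : probability Omega R) (theta : R).
Variables (V : nat -> {mfun Omega >-> nat}) (B : nat -> {mfun Omega >-> bool}).
Hypotheses (theta_gt0 : 0 < theta) (theta_lt1 : theta < 1).
Hypothesis VB : duplication_deletion P theta V B.

Local Notation G := (random_graph V B).

(** It grows slowly enough to be outrun by a contraction of rate 1 / n, while 1 / [sl] decreases by
    the order 1 / (n (log n)^(3/2)) of the weighted error. The shift by 2 keeps it positive at n =
    0. *)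
Let sl (n : nat) : R := Num.sqrt (ln n.+2%:R).

Let sl_gt0 n : 0 < sl n.
Proof. by rewrite sqrtr_gt0 ln_gt0// ltr1n. Qed.

Let sl2 n : sl n ^+ 2 = ln n.+2%:R.
Proof. by rewrite sqr_sqrtr// ln_ge0// ler1n. Qed.

Let sl_le n : sl n <= sl n.+1.
Proof. by rewrite ler_wsqrtr// ler_ln ?posrE// ler_nat. Qed.

(** Conditions under which the potential has nonpositive drift; for v >= 1 and suitable c they hold
    eventually, almost surely. The last one lets the contraction outrun the growth of [sl]. *)
Definition favourable (v : nat) (c : R) (n : nat) (g : lgraph) : Prop :=
  [/\ v \in vertices g, theta / 2 * n.+1%:R <= (nvertices g)%:R,
      c * ln n.+3%:R <= (max_degree g).+1%:R,
      24 <= (1 - theta) * (max_degree g)%:R & 1 <= (1 - theta) * ln n.+2%:R].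

(* The drift error 40 / (y^2 N) is at most 80 / (c^2 theta (n+1) (sl n.+1)^4); the
   factor 6 is lost when comparing the harmonic term with the increments of 1 / sl. *)
Let noise (c : R) : R := 40 * 12 / (c ^+ 2 * theta).

Let noise_ge0 c : 0 <= noise c.
Proof.
apply: divr_ge0; first by apply: mulr_ge0.
by apply: mulr_ge0; [exact: sqr_ge0|exact: ltW].
Qed.

Let potential v c (n : nat) (g : lgraph) : R :=
  sl n * hub_ratio R v g + noise c / sl n.

Let sl_le_potential v c n g : sl n * hub_ratio R v g <= potential v c n g.
Proof. by rewrite lerDl; apply: divr_ge0 (noise_ge0 c) (ltW (sl_gt0 n)). Qed.

Let step_mean_potential v c n g : 0 < c -> reachable n g -> favourable v c n g ->
  step_mean theta (potential v c n.+1) g <= potential v c n g.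
Proof.
move=> c0 gr [vg Nn Mc M24 ln1]; have [[_ _ g0] gn] := gr.
have hr := step_mean_hub_ratio theta_gt0 theta_lt1 gr vg M24.
have r0 : 0 <= hub_ratio R v g by exact: pronic_ratio_ge0.
rewrite /potential.
rewrite (_ : step_mean theta _ g = step_mean theta (hub_ratio R v) g * sl n.+1 +
    noise c / sl n.+1); last first.
  by rewrite -step_mean_affine//; congr step_mean; apply/funext => h; rewrite mulrC.
set r := hub_ratio R v g in hr r0 *.
move: (sl_gt0 n) (sl_gt0 n.+1) (sl2 n) (sl2 n.+1) (sl_le n).
set a := sl n; set b := sl n.+1 => a0 b0 a2 b2 ab.
have gap_le : b ^+ 2 - a ^+ 2 <= n.+2%:R^-1 by rewrite a2 b2; exact: ln_succ_le.
have gap_ge : n.+3%:R^-1 <= b ^+ 2 - a ^+ 2 by rewrite a2 b2; exact: ln_succ_ge.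
rewrite -a2 in ln1; rewrite -b2 in Mc.
have n1 : 0 < n.+1%:R :> R by [].
set X := 40 / _ / _ in hr *; set Y := 1 - _ / n.+1%:R in hr *.
pose u : R := n.+1%:R^-1.
have u0 : 0 < u by rewrite invr_gt0.
have gap_u : (b - a) * (b + a) <= u.
  rewrite -subr_sqr; apply: (le_trans gap_le).
  by rewrite lef_pV2 ?posrE// ler_nat.
have gap_u3 : u / 3 <= (b - a) * (b + a).
  rewrite -subr_sqr; apply: le_trans gap_ge.
  have n3 : (n.+3 <= n.+1 * 3)%N by clear; lia.
  by rewrite -invfM lef_pV2 ?posrE ?mulr_gt0// -natrM ler_nat.
(* Multiplied by b + a, the growth b - a becomes a difference of logarithms, at most 1 / (n + 1),
   while the contraction gains at least (1 - theta) a^2 / (n + 1). *)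
have contr : b * Y <= a.
  have : b - a <= b * ((1 - theta) / 2 * u).
    rewrite -(ler_pM2r (addr_gt0 b0 a0)); apply: (le_trans gap_u).
    rewrite [leRHS](_ : _ = u * ((1 - theta) / 2 * (b * (b + a)))); last by ring.
    rewrite ler_peMr ?(ltW u0)//; apply: (le_trans ln1).
    have ba : 2 * a ^+ 2 <= b * (b + a) by nra.
    have t1 : 0 <= (1 - theta) / 2 by rewrite divr_ge0// subr_ge0 ltW.
    have := ler_wpM2l t1 ba; lra.
  by rewrite /Y -/u mulrBr mulr1; lra.
(* The weighted error is O(1 / (n b^3)), and 1 / a - 1 / b = (b - a) / (a b) is at least 1 / (6 (n +
   1) b^3). *)
have source : b * X <= noise c / a - noise c / b.
  have cb0 : 0 < c * b ^+ 2 by rewrite mulr_gt0 ?exprn_gt0.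
  have tn0 : 0 < theta / 2 * n.+1%:R by rewrite !mulr_gt0 ?invr_gt0.
  have Xle : X <= 40 / (c * b ^+ 2) ^+ 2 / (theta / 2 * n.+1%:R).
    rewrite /X ler_pM ?divr_ge0 ?invr_ge0 ?exprn_ge0//.
      rewrite ler_wpM2l// lef_pV2 ?posrE ?exprn_gt0// lerXn2r ?nnegrE ?(ltW cb0)//.
    by rewrite lef_pV2 ?posrE ?ltr0n.
  apply: le_trans (ler_wpM2l (ltW b0) Xle) _.
  have [aN bN cN tN] : [/\ a != 0, b != 0, c != 0 & theta != 0] by rewrite !gt_eqF.
  have ab3 : u / (6 * b ^+ 3) <= (b - a) / (a * b).
    apply: (@le_trans _ _ ((b - a) / b ^+ 2)).
      rewrite ler_pdivrMr ?mulr_gt0 ?exprn_gt0//.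
      rewrite [leRHS](_ : _ = 6 * (b * (b - a))); last by field.
      have : (b - a) * (b + a) <= (b - a) * (2 * b) by rewrite ler_wpM2l ?subr_ge0//; lra.
      by move: gap_u3; lra.
    rewrite ler_wpM2l ?subr_ge0// lef_pV2 ?posrE ?mulr_gt0 ?exprn_gt0//.
    by rewrite expr2 ler_wpM2r// ltW.
  have := ler_wpM2l (noise_ge0 c) ab3; rewrite /noise /u.
  rewrite [X in X <= _](_ : _ = b * (40 / (c * b ^+ 2) ^+ 2 / (theta / 2 * n.+1%:R))); last first.
    by move: (n.+1%:R) n1 => m m0; field; rewrite ?aN ?bN ?cN ?tN ?gt_eqF.
  rewrite [X in _ <= X](_ : _ = noise c / a - noise c / b)//.
  by rewrite /noise; field; rewrite ?aN ?bN ?cN ?tN.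
have := ler_wpM2r (ltW b0) hr; have := ler_wpM2r r0 contr.
move: source; lra.
Qed.

(** Whenever v has maximal degree its ratio is 1 and the potential is at least [sl n], which
    eventually exceeds any bound. *)
Lemma ae_not_max_degree v : {ae P, forall w, \forall n \near \oo,
  ~~ has_max_degree (G n w) v}.
Proof.
(* Labels start at 1, so 0 is never a vertex. *)
case: v => [|v].
  by apply: aeW => w; apply: nearW => n; rewrite /has_max_degree mem_iota.
have [c c0 Mc] := ae_max_degree_ge theta_gt0 theta_lt1 VB.
have F_ge0 n g : reachable n g -> 0 <= potential v.+1 c n g.
  move=> _; apply: le_trans (sl_le_potential _ _ _ _).
  by rewrite mulr_ge0 ?pronic_ratio_ge0 ?(ltW (sl_gt0 n)).
have bd := ae_bounded VB F_ge0 (fun n g => @step_mean_potential v.+1 c n g c0).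
apply: filterS3 (ae_nvertices_ge theta_gt0 theta_lt1 VB) Mc bd => w Nw Mw /(_ _)[].
  near=> n.
  have Nn : theta / 2 * n.+1%:R <= (nvertices (G n w))%:R by near: n.
  have Mn : c * ln n.+3%:R <= (max_degree (G n w)).+1%:R by near: n.
  have vn : v.+1%:R <= theta / 2 * n.+1%:R.
    rewrite -ler_pdivrMl ?divr_gt0//; near: n; exact: near_le_nat.
  (* Chosen so that the lower bound on the maximal degree plus one is at least 24 / (1 - theta) +
     1. *)
  have c24 : (24 / (1 - theta) + 1) / c <= ln n.+1%:R by near: n; exact: near_le_ln.
  have t1 : 0 < 1 - theta by rewrite subr_gt0.
  have ln12 : ln n.+1%:R <= ln n.+2%:R :> R by rewrite ler_ln ?posrE// ler_nat.
  have ln23 : ln n.+2%:R <= ln n.+3%:R :> R by rewrite ler_ln ?posrE// ler_nat.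
  split=> //.
  - have vN : (v.+1 <= nvertices (G n w))%N by rewrite -(ler_nat R); exact: le_trans vn Nn.
    by rewrite mem_iota add1n /= ltnS.
  - rewrite mulrC -ler_pdivrMr// -(lerD2r 1) natr1; apply: le_trans Mn.
    by rewrite -ler_pdivrMl// mulrC; apply: (le_trans c24); exact: le_trans ln23.
  - rewrite mulrC -ler_pdivrMr//; apply: le_trans ln12.
    by near: n; exact: near_le_ln.
move=> L FL; near=> n; apply/negP => /andP[vg /eqP dM].
have : potential v.+1 c n (G n w) <= L by near: n.
rewrite leNgt => /negP; apply.
apply: lt_le_trans (sl_le_potential _ _ _ _).
rewrite /hub_ratio dM pronic_ratio_id mulr1.
apply: (@lt_le_trans _ _ (`|L| + 1)); first by rewrite ltr_pwDr// ler_norm.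
have L0 : 0 <= `|L| + 1 by rewrite addr_ge0.
rewrite -(ger0_norm L0) -sqrtr_sqr ler_wsqrtr//.
apply: (@le_trans _ _ (ln n.+1%:R)); first by near: n; exact: near_le_ln.
by rewrite ler_ln ?posrE// ler_nat.
Unshelve. all: by end_near. Qed.

Lemma ae_forall_not_max_degree : {ae P, forall w v, \forall n \near \oo,
  ~~ has_max_degree (G n w) v}.
Proof. by apply: ae_foralln => v; exact: ae_not_max_degree. Qed.

Lemma ae_max_degree_index_to_infinity : {ae P, forall w,
  (fun n => max_degree_index (G n w)) @ \oo --> \oo}.
Proof.
apply: filterS2 (ae_reachable VB) ae_forall_not_max_degree => w gr nv.
apply/cvgnyPge => K.
(* Only finitely many labels lie below K, so eventually none of them has maximal degree. *)
have : \forall n \near \oo, forall v, (v < K)%N -> ~~ has_max_degree (G n w) v.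
  elim: K => [|K IHK]; first exact: nearW.
  near=> n => v; rewrite ltnS leq_eqVlt => /orP[/eqP->|]; first by near: n; exact: nv.
  by move: v; near: n.
apply: filterS => n nK; rewrite leqNgt; apply/negP => /nK/negP; apply.
have [[_ _ g0] _] := gr n; have [v vm] := exists_max_degree g0.
(* The list of vertices of maximal degree is nonempty, so its head is such a vertex and not the
   default 0. *)
rewrite /max_degree_index; set s := [seq _ <- _ | _].
have : v \in s by rewrite mem_filter vm; have /andP[] := vm.
case sE : s => [//|u s'] _ /=.
have : u \in s by rewrite sE inE eqxx.
by rewrite mem_filter => /andP[].
Unshelve. all: by end_near. Qed.

End no_hub.

Theorem mainTheorem4 (R : realType) (d : measure_display)
    (Omega : measurableType d) (P : probability Omega R) (theta : R)
    (V : nat -> {mfun Omega >-> nat}) (B : nat -> {mfun Omega >-> bool})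
    (theta_gt0 : 0 < theta) (theta_lt1 : theta < 1)
    (VB : duplication_deletion P theta V B) :
  {ae P, forall w,
    (fun n => max_degree_index (random_graph V B n w)) @ \oo --> \oo} /\
  {ae P, forall w, ~ exists v : nat,
    \forall n \near \oo, has_max_degree (random_graph V B n w) v}.
Proof.
split; first exact: ae_max_degree_index_to_infinity theta_gt0 theta_lt1 VB.
have := ae_forall_not_max_degree theta_gt0 theta_lt1 VB.
apply: filterS => w nv [v vm].
have [n []] := filter_ex (filterI (nv v) vm).
by move=> /negP.
Qed.
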